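(* Let $G$ be a group and let $K \unlhd G$ be a normal subgroup such that $G/K$ is a torsion group. 1. The monoid $\mathcal B_K(G)$ is a BF-monoid, and its complete integral closure $\widehat{\mathcal B_K(G)}$ is a Krull monoid. Moreover, except in the case where $|G|=2$ and $|K|=1$, the embedding $\widehat{\mathcal B_K(G)} \hookrightarrow \mathcal F(G)$ is a divisor theory with class group $\mathcal F(G)/\mathcal B_K(G)$, which is isomorphic to $G/KG'$, and every class contains precisely $|KG'|$ prime divisors. In particular, if $G/K$ is finite, then the monoid $\mathcal B_K(G)$ is a finitely generated C-monoid, $\mathsf D_K(G)$ is finite, and $\widehat{\mathcal B_K(G)}$ is a finitely generated Krull monoid. 2. The following statements are equivalent: (a) $G' \subseteq K$. (b) $\mathcal B_K(G)$ is a Krull monoid. (c) $\mathcal B_K(G)$ is completely integrally closed. (d) $\mathcal B_K(G)$ is root-closed. (e) $\mathcal B_K(G)$ is a transfer Krull monoid. (f) $\mathcal B_K(G)$ is a weakly Krull monoid. (g) The embedding $\mathcal B_K(G) \hookrightarrow \mathcal F(G)$ is a divisor theory. (h) The embedding $\mathcal B_K(G) \hookrightarrow \mathcal F(G)$ is a divisor homomorphism. (i) The class semigroup of $\mathcal B_K(G)$ in $\mathcal F(G)$ is a group. If this is the case, then the class semigroup of $\mathcal B_K(G)$ in $\mathcal F(G)$ is isomorphic to $G/K$.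
   Context: Groups are written multiplicatively and need not be finite; $1_G$ is the identity and $G'$ the commutator subgroup of $G$. $\mathbb N$ is the set of positive integers. Sequences: $\mathcal F(G)$ is the free abelian monoid with basis (the set) $G$; its elements $S=g_1\boldsymbol{\cdot}\ldots\boldsymbol{\cdot} g_\ell$ are called sequences over $G$ (finite unordered collections of terms with repetition), $\boldsymbol{\cdot}$ is concatenation, and $|S|=\ell$ is the length. The set of products is $\pi(S)=\{g_{\sigma(1)}\cdots g_{\sigma(\ell)} \in G : \sigma \text{ a permutation of } \{1,\dots,\ell\}\}$ (with $\pi=\{1_G\}$ for the empty sequence). For $K\unlhd G$, $S$ is product-$K$ if $\pi(S)\cap K\ne\emptyset$; $\mathcal B_K(G)$ is the submonoid of $\mathcal F(G)$ of all product-$K$ sequences, and $\mathsf D_K(G)=\sup\{|S| : S \text{ is an atom of } \mathcal B_K(G)\}$. Monoids: a monoid is a commutative cancellative semigroup with identity. For a monoid $H$, $H^\times$ is its group of units and $\mathsf q(H)$ its quotient group. An atom is an irreducible element (non-unit that is not a product of two non-units). $H$ is atomic if every non-unit is a finite product of atoms. For a non-unit $a$, $\mathsf L(a)$ is the set of all $k\in\mathbb N$ such that $a$ is a product of $k$ atoms; $\mathsf L(a)=\{0\}$ for a unit $a$. $H$ is a BF-monoid if it is atomic and $\mathsf L(a)$ is finite and non-empty for all $a\in H$. $H$ is factorial if it is atomic and every element has a unique factorization into atoms (up to order and associates). Closures: $\widetilde H=\{x\in\mathsf q(H): x^N\in H\text{ for some }N\in\mathbb N\}$ (root closure) and $\widehat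 H=\{x\in\mathsf q(H): \text{there is } c\in H \text{ with } cx^n\in H \text{ for all } n\in\mathbb N\}$ (complete integral closure). $H$ is root-closed if $H=\widetilde H$, and completely integrally closed if $H=\widehat H$. Here $\mathsf q(\mathcal B_K(G))\subseteq\mathsf q(\mathcal F(G))$ and $\widehat{\mathcal B_K(G)}\subseteq \mathcal F(G)$. Homomorphisms: a monoid homomorphism $\varphi:H\to D$ is a divisor homomorphism if $\varphi(a)\mid\varphi(b)$ in $D$ implies $a\mid b$ in $H$ for all $a,b\in H$; it is a divisor theory if $D$ is free abelian, $\varphi$ is a divisor homomorphism, and for every $x\in D$ there are $a_1,\dots,a_n\in H$ with $x=\gcd(\varphi(a_1),\dots,\varphi(a_n))$. It is a transfer homomorphism if (T1) $D=\varphi(H)D^\times$ and $\varphi^{-1}(D^\times)=H^\times$, and (T2) whenever $u\in H$, $b,c\in D$ and $\varphi(u)=bc$, there are $v,w\in H$ with $u=vw$, $\varphi(v)D^\times=bD^\times$ and $\varphi(w)D^\times=cD^\times$. $H$ is a Krull monoid if there is a divisor homomorphism from $H$ into a free abelian monoid (equivalently, $H$ has a divisor theory). $H$ is a transfer Krull monoid if it has a transfer homomorphism to a Krull monoid. If $\varphi:H\to F$ is a divisor theory, the class group is $\mathsf q(F)/\mathsf q(\varphi(H))$; the prime divisors in a class are the elements of the basis of $F$ lying in that class (for $F=\mathcal F(G)$ these are the elements of $G$). $\mathcal F(G)/\mathcal B_K(G)$ denotes $\{S\,\mathsf q(\mathcal B_K(G)) : S\in\mathcal F(G)\}$, which for $G/K$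 torsion equals the group $\mathsf q(\mathcal F(G))/\mathsf q(\mathcal B_K(G))$. An $s$-ideal of $H$ is a subset $\mathfrak a\subseteq H$ with $\mathfrak aH=\mathfrak a$ (the empty set is allowed); it is prime if $H\setminus\mathfrak a$ is a submonoid of $H$. $\mathfrak X(H)$ is the set of minimal non-empty prime $s$-ideals, and $H_{\mathfrak p}=(H\setminus\mathfrak p)^{-1}H\subseteq\mathsf q(H)$. $H$ is weakly Krull if $H=\bigcap_{\mathfrak p\in\mathfrak X(H)}H_{\mathfrak p}$ and each element of $H$ is contained in only finitely many $\mathfrak p\in\mathfrak X(H)$. Class semigroups: for monoids $H\subseteq F$ and $y,y'\in F$, put $y\sim_H y'$ iff $y^{-1}F\cap H=(y')^{-1}F\cap H$ in the sense of the congruence on $F$: for all $x\in F$, $yx\in H\Leftrightarrow y'x\in H$. The class of $y$ is $[y]^F_H$. The class semigroup of $H$ in $F$ is $\mathcal C(H,F)=\{[y]^F_H : y\in F\}$ with operation $[x]^F_H+[y]^F_H=[xy]^F_H$; the reduced class semigroup is $\mathcal C^*(H,F)=\{[y]^F_H : y\in(F\setminus F^\times)\cup\{1\}\}$. $H$ is a C-monoid if it is a submonoid of a factorial monoid $F$ with $H\cap F^\times=H^\times$ and $\mathcal C^*(H,F)$ finite.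
   Formalization: ''Finitely generated'' (for B_K(G) and its complete integral closure) is asserted only when K is finite as well as G/K, since it fails for infinite K (e.g. G=K=Z); and (g) is required only outside the case |G|=2, |K|=1, where (a) holds but (g) fails. *)

(* Defs.v *)
From mathcomp Require Import all_boot all_order all_algebra.
From mathcomp Require Import boolp classical_sets functions cardinality.
From mathcomp.multinomials Require Import freeg.

Set Implicit Arguments.
Unset Strict Implicit.
Unset Printing Implicit Defensive.

Import Order.TTheory GRing.Theory.

Local Open Scope classical_set_scope.
Local Open Scope ring_scope.

(* A monoid (commutative, cancellative, with identity) embeds in its quotient
   group, so a monoid is given here as a submonoid H : set V of an abelian
   group V : zmodType, and is written additively: 0 is the identity, x + y the
   product, x *+ n the n-th power and x - y a fraction. *)

Section Structures.

Definition magma_isomorphic (T U : Type) (A : set T) (opA : T -> T -> T)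
    (B : set U) (opB : U -> U -> U) : Prop :=
  exists2 f : T -> U, set_bij A B f &
    forall x y, A x -> A y -> f (opA x y) = opB (f x) (f y).

Definition is_group (T : Type) (A : set T) (op : T -> T -> T) : Prop :=
  [/\ forall x y, A x -> A y -> A (op x y),
      forall x y z, A x -> A y -> A z -> op x (op y z) = op (op x y) z &
      exists2 e, A e &
        (forall x, A x -> op e x = x /\ op x e = x) /\
        (forall x, A x -> exists2 y, A y & op x y = e /\ op y x = e)].

End Structures.

Section Monoids.
Variable V : zmodType.
Implicit Types (H F A B p : set V) (a b c x y z : V).

Definition addset A B : set V := [set a + b | a in A & b in B].
Definition addcoset x A : set V := [set x + a | a in A].

Definition submonoid H : Prop :=
  H 0 /\ forall x y, H x -> H y -> H (x + y).

Definition quotient_group H : set V := [set a - b | a in H & b in H].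

Definition munits H : set V := [set x | H x /\ H (- x)].

Definition mdivides H a b : Prop := exists2 c, H c & b = a + c.

Definition massociated H a b : Prop :=
  addcoset a (munits H) = addcoset b (munits H).

Definition atom H : set V :=
  [set a | [/\ H a, ~ munits H a &
    forall b c, H b -> H c -> a = b + c -> munits H b \/ munits H c]].

Definition factorization H a (s : seq V) : Prop :=
  (forall x, x \in s -> atom H x) /\ a = \sum_(x <- s) x.

Definition lengths H a : set nat :=
  [set k | (munits H a /\ k = 0%N) \/
           (~ munits H a /\ exists2 s, size s = k & factorization H a s)].

Definition atomic H : Prop :=
  submonoid H /\
  forall a, H a -> ~ munits H a -> exists s, factorization H a s.

Definition BF_monoid H : Prop :=
  atomic H /\ forall a, H a -> finite_set (lengths H a) /\ lengths H a !=set0.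

Definition factorial_monoid H : Prop :=
  atomic H /\
  forall a s t, factorization H a s -> factorization H a t ->
    exists2 t', perm_eq t t' &
      size s = size t' /\
      forall i, (i < size s)%N -> massociated H s`_i t'`_i.

Definition finitely_generated H : Prop :=
  submonoid H /\
  exists2 A, finite_set A /\ A `<=` H &
    forall x, H x ->
      exists2 s : seq V, (forall y, y \in s -> A y) & x = \sum_(y <- s) y.

Definition root_closure H : set V :=
  [set x | quotient_group H x /\ exists2 n, (0 < n)%N & H (x *+ n)].

Definition complete_integral_closure H : set V :=
  [set x | quotient_group H x /\
           exists2 c, H c & forall n, (0 < n)%N -> H (c + x *+ n)].

Definition root_closed H : Prop := H = root_closure H.

Definition completely_integrally_closed H : Prop :=
  H = complete_integral_closure H.

Definition is_gcd H (A : set V) x : Prop :=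
  [/\ H x, forall a, A a -> mdivides H x a &
      forall y, H y -> (forall a, A a -> mdivides H y a) -> mdivides H y x].

Definition s_ideal H p : Prop := p `<=` H /\ addset p H = p.

Definition prime_s_ideal H p : Prop := s_ideal H p /\ submonoid (H `\` p).

Definition minimal_primes H : set (set V) :=
  [set p | [/\ prime_s_ideal H p, p !=set0 &
    forall q, prime_s_ideal H q -> q !=set0 -> q `<=` p -> q = p]].

Definition localization H p : set V := [set a - s | a in H & s in H `\` p].

(* The factor quotient_group H matters only when minimal_primes H is empty. *)
Definition weakly_Krull H : Prop :=
  [/\ submonoid H,
      H = quotient_group H `&`
            \bigcap_(p in minimal_primes H) localization H p &
      forall a, H a -> finite_set [set p | minimal_primes H p /\ p a]].

Definition class_equiv H F y y' : Prop :=
  forall x, F x -> (H (y + x) <-> H (y' + x)).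

Definition class_of H F y : set V := [set y' | F y' /\ class_equiv H F y y'].

Definition class_semigroup H F : set (set V) := [set class_of H F y | y in F].

Definition reduced_class_semigroup H F : set (set V) :=
  [set class_of H F y | y in (F `\` munits F) `|` [set 0]].

Definition class_add H F A B : set V :=
  [set z | exists x y, [/\ A x, B y & class_of H F (x + y) z]].

Lemma class_addE H F x y : submonoid F -> F x -> F y ->
  class_add H F (class_of H F x) (class_of H F y) = class_of H F (x + y).
Proof.
move=> [F0 FD] Fx Fy; apply/seteqP; split=> z /=; last first.
  by move=> zxy; exists x, y.
move=> [x' [y' [[Fx' ex] [Fy' ey] [Fz ez]]]]; split=> // w Fw.
rewrite -(ez w Fw) -!addrA (ex _ (FD _ _ Fy Fw)).
by rewrite (addrCA x' y) (ey _ (FD _ _ Fx' Fw)) (addrCA y' x').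
Qed.

End Monoids.

Section Homomorphisms.
Variables V W : zmodType.
Implicit Types (H : set V) (D : set W) (phi : V -> W).

(* Only the values of phi on H matter. *)
Definition monoid_hom H D phi : Prop :=
  [/\ submonoid H, submonoid D, forall a, H a -> D (phi a), phi 0 = 0 &
      forall a b, H a -> H b -> phi (a + b) = phi a + phi b].

Definition divisor_hom H D phi : Prop :=
  monoid_hom H D phi /\
  forall a b, H a -> H b -> mdivides D (phi a) (phi b) -> mdivides H a b.

Definition transfer_hom H D theta : Prop :=
  [/\ monoid_hom H D theta,
      D = addset (theta @` H) (munits D),
      forall a, H a -> (munits D (theta a) <-> munits H a) &
      forall u b c, H u -> D b -> D c -> theta u = b + c ->
        exists v w, [/\ H v, H w, u = v + w,
          massociated D (theta v) b & massociated D (theta w) c]].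

Definition class_group H D phi : set (set W) :=
  [set addcoset x (quotient_group (phi @` H)) | x in quotient_group D].

End Homomorphisms.

(* {freeg P} is the free abelian group on P. The monoid F(P) of sequences over
   P is its submonoid generated by P, and seq_sum s is the sequence whose terms
   are listed (in some order) by s. *)
Section Sequences.
Variable P : choiceType.

Definition seq_sum (s : seq P) : {freeg P} := \sum_(x <- s) << x >>.

Definition free_monoid : set {freeg P} := range seq_sum.

Lemma coeff_seq_sum (s : seq P) x : coeff x (seq_sum s) = (count_mem x s)%:R.
Proof.
rewrite /seq_sum raddf_sum /=; elim: s => [|y s IHs]; first by rewrite big_nil.
by rewrite big_cons IHs coeffU mul1r natrD.
Qed.

Lemma seq_sumP (s t : seq P) : seq_sum s = seq_sum t <-> perm_eq s t.
Proof.
split=> [est|/permP est]; last first.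
  by apply/eqP/freeg_eqP => x; rewrite !coeff_seq_sum est.
apply/allP => x _ /=; apply/eqP.
have /eqP : coeff x (seq_sum s) = coeff x (seq_sum t) by rewrite est.
by rewrite !coeff_seq_sum Num.Theory.eqr_nat => /eqP.
Qed.

End Sequences.

Arguments free_monoid P : clear implicits.

Definition free_abelian (V : zmodType) (D : set V) : Prop :=
  submonoid D /\
  exists P : choiceType, magma_isomorphic (free_monoid P) +%R D +%R.

Definition divisor_theory (V W : zmodType) (H : set V) (D : set W)
    (phi : V -> W) : Prop :=
  [/\ free_abelian D, divisor_hom H D phi &
      forall x, D x -> exists2 s : seq V, s <> [::] /\ (forall a, a \in s -> H a) &
        is_gcd D [set phi a | a in [set` s]] x].

Definition Krull (V : zmodType) (H : set V) : Prop :=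
  exists (W : zmodType) (D : set W) (phi : V -> W),
    free_abelian D /\ divisor_hom H D phi.

Definition transfer_Krull (V : zmodType) (H : set V) : Prop :=
  exists (W : zmodType) (D : set W) (theta : V -> W),
    Krull D /\ transfer_hom H D theta.

(* H is identified with its image under an embedding iota into F. *)
Definition C_monoid (V : zmodType) (H : set V) : Prop :=
  exists (W : zmodType) (F : set W) (iota : V -> W),
    [/\ factorial_monoid F, monoid_hom H F iota, set_inj H iota,
        iota @` H `&` munits F = munits (iota @` H) &
        finite_set (reduced_class_semigroup (iota @` H) F)].

Section Groups.
Variable G : groupType.
Implicit Types (K A B : set G).

Definition subgroup K : Prop :=
  [/\ K 1%g, forall x y, K x -> K y -> K (x * y)%g &
      forall x, K x -> K (x^-1)%g].

Definition normal_subgroup K : Prop :=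
  subgroup K /\ forall x g, K x -> K (x ^ g)%g.

Definition mulset A B : set G := [set (a * b)%g | a in A & b in B].

(* The elements of G/K, for K normal, are the cosets gK; their product is the
   product of subsets. *)
Definition quotient K : set (set G) := [set mulset [set g] K | g in [set: G]].

Definition torsion_quotient K : Prop :=
  forall g : G, exists2 n, (0 < n)%N & K (g ^+ n)%g.

Definition commutator_subgroup : set G :=
  smallest subgroup [set [~ x, y]%g | x in [set: G] & y in [set: G]].

Definition products (S : {freeg G}) : set G :=
  [set (\prod_(g <- s) g)%g | s in [set s | seq_sum s = S]].

Definition product_monoid K : set {freeg G} :=
  [set S | free_monoid G S /\ products S `&` K !=set0].

Definition atom_lengths K : set nat :=
  [set size s | s in [set s | atom (product_monoid K) (seq_sum s)]].

(* The supremum of the lengths of the atoms exists in N and equals d. *)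
Definition Davenport_constant K (d : nat) : Prop :=
  supremums (atom_lengths K) d.

Definition residue_classes K : set (set {freeg G}) :=
  [set addcoset S (quotient_group (product_monoid K)) | S in free_monoid G].

End Groups.

Arguments commutator_subgroup G : clear implicits.

(* Main.v *)
Require Import Defs.
From HB Require Import structures.
From mathcomp Require Import all_boot all_order all_algebra.
From mathcomp Require Import zify.
From mathcomp Require Import boolp classical_sets functions cardinality.
From mathcomp.multinomials Require Import freeg.

Set Implicit Arguments.
Unset Strict Implicit.
Unset Printing Implicit Defensive.

Import Order.TTheory GRing.Theory Num.Theory.
Local Open Scope classical_set_scope.
Local Open Scope card_scope.
Local Open Scope ring_scope.

(** Write N = KG'. Modulo N the product of a sequence does not depend on the
    order of its terms, so the product monoid B_N over N is divisor-closed in the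
    monoid F of all sequences: the inclusion of B_N in F is a divisor homomorphism.

    The link between B = B_K and B_N is a rearrangement trick
    ([commutator_rearrangement]): for w in G' some sequence has both 1 and w among
    its products. Hence each s in B_N has a companion t with t and s + t both in
    B ([mulset_commutators_rearrangement]). Thus B and B_N have the same quotient
    group, and since G/K is torsion, B_N is both the root closure and the complete
    integral closure of B. Everything about the closure is then read off from B_N:
    it is Krull, its class group is G/N, and the terms lying in a given class form
    a coset of N. A sequence s outside B_N is the gcd of two members s + h and
    s + u + v, where h = uv inverts the product of s; this requires some u other
    than 1 and h, which fails only if |G| = 2 and |K| = 1
    ([divisor_theory_product_monoid], [third_element]).

    In the second part every condition forces G' to lie in K, and G' in K gives
    B = B_N and with it every condition. If B equals its closure, one-term
    sequences w with w in G' lie in B. If B is transfer Krull and w in G' has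
    order m > 1 modulo K, the sequence of m copies of w is an atom, but its image
    is m times a non-unit, because Krull monoids are root-closed
    ([transfer_Krull_atom]). If B is weakly Krull, one uses that its minimal primes
    are the sets of members of B containing a fixed term g ([minimal_primesE]);
    if |G| > 2, the rearranged sequences can be chosen to avoid g, so w lies in
    every localization. For divisor homomorphisms and for the class semigroup, suitable
    products of sequences containing x and y are compared directly.

    If G/K is finite, two pigeonhole arguments on products of initial segments
    suffice: a long sequence splits ([cut_trivial_segment]), which bounds the
    atoms, and a term that occurs very often can be removed in blocks
    ([remove_power]), which leaves finitely many classes and makes B a C-monoid in
    F. *)

(** * Submonoids of abelian groups and their quotient groups *)

Section QuotientOfSubmonoid.
Variables (V : zmodType) (H : set V) (subH : submonoid H).

Lemma submonoidMn x n : H x -> H (x *+ n).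
Proof.
case: subH => H0 HD Hx; elim: n => [|n IHn]; first by rewrite mulr0n.
by rewrite mulrS; apply: HD.
Qed.

Lemma submonoid_sum (I : eqType) (s : seq I) (f : I -> V) :
  (forall i, i \in s -> H (f i)) -> H (\sum_(i <- s) f i).
Proof.
case: subH => H0 HD Hf; rewrite big_seq.
by elim/big_ind: _ => // i /Hf.
Qed.

Lemma quotient_group_id x : H x -> quotient_group H x.
Proof. by move=> Hx; exists x => //; exists 0; [case: subH | rewrite subr0]. Qed.

Lemma quotient_group_submonoid : submonoid (quotient_group H).
Proof.
case: subH => H0 HD; split; first exact: quotient_group_id.
move=> _ _ [a Ha [b Hb <-]] [c Hc [d Hd <-]].
exists (a + c); first exact: HD.
by exists (b + d); [exact: HD | rewrite opprD addrACA].
Qed.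

Lemma quotient_groupN x : quotient_group H x -> quotient_group H (- x).
Proof. by move=> [a Ha [b Hb <-]]; exists b => //; exists a; rewrite // opprB. Qed.

Lemma addcoset_eq x y :
  addcoset x (quotient_group H) = addcoset y (quotient_group H) <->
  quotient_group H (x - y).
Proof.
have [Q0 QD] := quotient_group_submonoid.
split=> [exy | Qxy].
  have: addcoset x (quotient_group H) x by exists 0; rewrite ?addr0.
  by rewrite exy => -[z Qz <-]; rewrite addrC addKr.
apply/seteqP; split=> _ [z Qz <-].
  by exists (x - y + z); [exact: QD | rewrite addrA addrCA subrr addr0].
exists (y - x + z); last by rewrite addrA addrCA subrr addr0.
by apply: QD => //; rewrite -opprB; apply: quotient_groupN.
Qed.

Lemma addset_addcoset x y :
  addset (addcoset x (quotient_group H)) (addcoset y (quotient_group H)) =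
  addcoset (x + y) (quotient_group H).
Proof.
have [Q0 QD] := quotient_group_submonoid.
apply/seteqP; split=> [_ [_ [a Qa <-] [_ [b Qb <-] <-]] | _ [a Qa <-]].
  by exists (a + b); [exact: QD | rewrite addrACA].
exists (x + a); first by exists a.
by exists (y + 0); [exists 0 | rewrite addr0 addrAC].
Qed.

End QuotientOfSubmonoid.

(** Used with H a product monoid and L its closure: both have the same quotient
    group, hence the same class group. *)
Lemma quotient_group_between (V : zmodType) (H L : set V) : submonoid H ->
  H `<=` L -> L `<=` quotient_group H -> quotient_group L = quotient_group H.
Proof.
move=> subH HL LQ; apply/seteqP; split=> [_ [a /LQ Qa [b /LQ Qb <-]] | ].
  by apply: (quotient_group_submonoid subH).2 => //; apply: quotient_groupN.
by move=> _ [a /HL Ha [b /HL Hb <-]]; exists a => //; exists b.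
Qed.

Lemma not_atom_split (V : zmodType) (H : set V) a :
  H a -> ~ munits H a -> ~ atom H a -> exists b c,
    [/\ H b, H c, a = b + c, ~ munits H b & ~ munits H c].
Proof.
move=> Ha NUa Nat; apply: contrapT => Nbc; apply: Nat; split=> // b c Hb Hc ea.
by apply: contrapT => /not_orP [nb nc]; apply: Nbc; exists b, c.
Qed.

(** * Free abelian monoids and their submonoids *)

Section FreeMonoid.
Variable P : choiceType.
Notation F := (free_monoid P).

Lemma seq_sum_cat (s t : seq P) : seq_sum (s ++ t) = seq_sum s + seq_sum t.
Proof. exact: big_cat. Qed.

Lemma seq_sum_nil : seq_sum [::] = 0 :> {freeg P}.
Proof. exact: big_nil. Qed.

Lemma seq_sum_cons x (s : seq P) : seq_sum (x :: s) = << x >> + seq_sum s.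
Proof. exact: big_cons. Qed.

Lemma seq_sum1 x : seq_sum [:: x] = << x >> :> {freeg P}.
Proof. exact: big_seq1. Qed.

Lemma seq_sum_nseq n (x : P) : seq_sum (nseq n x) = << x >> *+ n.
Proof.
elim: n => [|n IHn]; first by rewrite seq_sum_nil mulr0n.
by rewrite mulrS -IHn -seq_sum_cons.
Qed.

Lemma deg_seq_sum (s : seq P) : deg (seq_sum s) = (size s)%:Z.
Proof.
elim: s => [|x s IHs]; first by rewrite seq_sum_nil deg0.
by rewrite seq_sum_cons degD degU IHs.
Qed.

Lemma submonoid_free : submonoid F.
Proof.
split; first by exists [::]; rewrite ?seq_sum_nil.
by move=> _ _ [s _ <-] [t _ <-]; exists (s ++ t); rewrite ?seq_sum_cat.
Qed.

Lemma free_monoid1 x : F << x >>.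
Proof. by exists [:: x]; rewrite ?seq_sum1. Qed.

(** An element of the free abelian group is a finite combination of basis
    elements, so nonnegative coefficients make it a sum of basis elements. *)
Lemma freeP x : F x <-> forall p, 0 <= coeff p x.
Proof.
split=> [[s _ <-] p | x_ge0]; first by rewrite coeff_seq_sum ler0n.
rewrite -[x]freeg_sumE; apply: submonoid_sum; first exact: submonoid_free.
move=> p _; have [n ->] : exists n, coeff p x = n%:Z.
  by case: (coeff p x) (x_ge0 p) => // n _; exists n.
by rewrite -natz -freegU_muln; apply: (submonoidMn submonoid_free); apply: free_monoid1.
Qed.

Lemma mdivides_freeP x y :
  mdivides F x y <-> forall p, coeff p x <= coeff p y.
Proof.
split=> [[c /freeP c_ge0 -> p] | le_xy]; first by rewrite coeffD lerDl.
exists (y - x); last by rewrite addrC subrK.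
by apply/freeP => p; rewrite coeffB subr_ge0.
Qed.

Lemma free_monoid_reduced x : F x -> F (- x) -> x = 0.
Proof.
move=> [s _ <-] [t _ est]; have: seq_sum (s ++ t) = seq_sum [::].
  by rewrite seq_sum_cat est seq_sum_nil subrr.
move=> /seq_sumP /perm_size; rewrite size_cat => /eqP.
by rewrite addn_eq0 => /andP [/nilP -> _]; rewrite seq_sum_nil.
Qed.

Section SubmonoidOfFree.
Variables (H : set {freeg P}) (subH : submonoid H) (HF : H `<=` F).

Lemma munits_sub_free : munits H = [set 0].
Proof.
apply/seteqP; split=> [x [Hx HNx] | _ ->]; first by apply: free_monoid_reduced; apply: HF.
by split; rewrite ?oppr0; case: subH.
Qed.

(** Otherwise a proper segment of product 1 in the quotient could be split off. *)
Lemma atom_size_gt0 s : atom H (seq_sum s) -> (0 < size s)%N.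
Proof.
move=> [_]; rewrite munits_sub_free; case: s => // s0 _.
by case: s0; exact: seq_sum_nil.
Qed.

(** A non-atom splits into two nonempty, hence strictly shorter, sequences, so
    the induction is on the length. *)
Lemma sub_free_atomic : atomic H.
Proof.
split=> // _ /[dup] /HF [s _ <-].
have [n] := ubnP (size s); elim: n => // n IHn in s *; rewrite ltnS => le_sn Hs.
move=> s_neq0; have [Hat | Nat] := pselect (atom H (seq_sum s)).
  by exists [:: seq_sum s]; split=> [x|]; [rewrite inE => /eqP -> | rewrite big_seq1].
have [b [c [Hb Hc es b0 c0]]] := not_atom_split Hs s_neq0 Nat.
move: b0 c0 es (Hb) (Hc); case/HF: Hb => sb _ <-; case/HF: Hc => sc _ <-.
rewrite munits_sub_free => sb0 sc0; rewrite -seq_sum_cat.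
move=> /seq_sumP est Hb Hc; have := perm_size est; rewrite size_cat.
have sb_gt0 : (0 < size sb)%N by case: (sb) sb0 => // /(_ seq_sum_nil).
have sc_gt0 : (0 < size sc)%N by case: (sc) sc0 => // /(_ seq_sum_nil).
move=> esz.
have [||f1 [f1A f1E]] := IHn sb _ Hb; rewrite ?munits_sub_free //.
  by rewrite (leq_trans _ le_sn) // esz -[X in (X < _)%N]addn0 ltn_add2l.
have [||f2 [f2A f2E]] := IHn sc _ Hc; rewrite ?munits_sub_free //.
  by rewrite (leq_trans _ le_sn) // esz -[X in (X < _)%N]add0n ltn_add2r.
exists (f1 ++ f2); split.
  by move=> x; rewrite mem_cat => /orP [/f1A | /f2A].
by rewrite big_cat /= -f1E -f2E -seq_sum_cat; apply/seq_sumP.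
Qed.

(** Every atom has length at least 1 and lengths add up: this is what bounds the
    sets of lengths. *)
Lemma size_factorization_le s f :
  factorization H (seq_sum s) f -> (size f <= size s)%N.
Proof.
move=> [fA es]; have := deg_seq_sum s; rewrite {}es.
elim: f fA s => [|x f IHf] fA s; first by [].
rewrite big_cons degD => e.
have xA : atom H x by apply: fA; rewrite inE eqxx.
have [t _ et] := HF (let: And3 Hx _ _ := xA in Hx).
have [u _ eu] : F (\sum_(y <- f) y).
  apply: (submonoid_sum submonoid_free) => y fy; apply: HF.
  by have [] := fA y; rewrite ?inE ?fy ?orbT.
have := IHf _ u; rewrite -eu deg_seq_sum => /(_ _ erefl) le_fu.
move: e; rewrite -et -eu !deg_seq_sum -PoszD => -[<-].
rewrite -et in xA; have := atom_size_gt0 xA.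
have: (size f <= size u)%N by apply: le_fu => y fy; apply: fA; rewrite inE fy orbT.
by rewrite /=; lia.
Qed.

Lemma sub_free_BF : BF_monoid H.
Proof.
split=> [|a Ha]; first exact: sub_free_atomic.
have [s _ es] := HF Ha; split.
  apply: (sub_finite_set _ (finite_II (size s).+1)) => k /= [[_ ->] //|].
  by move=> [_ [f <- ]]; rewrite -es ltnS => /size_factorization_le.
have [Ua | NUa] := pselect (munits H a); first by exists 0%N; left.
have [f fa] := sub_free_atomic.2 a Ha NUa.
by exists (size f); right; split=> //; exists f.
Qed.

Lemma sub_free_finitely_generated :
  finite_set (atom H) -> finitely_generated H.
Proof.
move=> finA; split=> //; exists (atom H); first by split=> // x [].
move=> x Hx; have [] := pselect (munits H x).
  by rewrite munits_sub_free => ->; exists [::]; rewrite ?big_nil.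
by move=> /(sub_free_atomic.2 x Hx) [f [fA fE]]; exists f.
Qed.

Lemma sub_free_monoid_hom : monoid_hom H F id.
Proof. by split=> //; exact: submonoid_free. Qed.

End SubmonoidOfFree.

Lemma free_abelian_free : free_abelian F.
Proof.
split; first exact: submonoid_free.
by exists P, id => //; split=> //; move=> x Fx; exists x.
Qed.

Lemma atom_free x : atom F x -> exists p, x = << p >>.
Proof.
have mu : munits F = [set 0] by apply: munits_sub_free => //; exact: submonoid_free.
move=> [[s _ <-]]; rewrite mu.
case: s => [|p s] ns; first by case: ns; exact: seq_sum_nil.
move=> /(_ << p >> (seq_sum s) (free_monoid1 p)) H; exists p.
have [|p0|s0] := H _ (seq_sum_cons p s); first by exists s.
  by have := p0; rewrite /= -seq_sum_nil -seq_sum1 => /seq_sumP /perm_size.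
by rewrite seq_sum_cons [seq_sum s]s0 addr0.
Qed.

Lemma factorial_free : factorial_monoid F.
Proof.
split; first by apply: sub_free_atomic => //; exact: submonoid_free.
have atomsE (f : seq {freeg P}) : (forall x, x \in f -> atom F x) ->
    exists s, f = [seq << p >> | p <- s].
  elim: f => [|x f IHf] fA; first by exists [::].
  have [s ->] := IHf (fun y fy => fA y (mem_behead (s := x :: f) fy)).
  by have [p ->] := atom_free (fA x (mem_head x f)); exists (p :: s).
move=> a f g [/atomsE [s ->] ea] [/atomsE [t ->]]; rewrite {}ea !big_map.
move=> /seq_sumP est; exists [seq << p >> | p <- s] => //.
by apply: perm_map; rewrite perm_sym.
Qed.
End FreeMonoid.

(** * Krull and transfer Krull monoids *)

Section KrullMonoids.

Lemma monoid_homMn (V W : zmodType) (H : set V) (D : set W) phi a n :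
  monoid_hom H D phi -> H a -> phi (a *+ n) = phi a *+ n.
Proof.
move=> [subH _ _ phi0 phiD] Ha; elim: n => [|n IHn]; first by rewrite !mulr0n.
by rewrite !mulrS phiD ?IHn //; apply: submonoidMn.
Qed.

Lemma free_abelian_hom (V : zmodType) (D : set V) : free_abelian D ->
  exists (P : choiceType) (f : {freeg P} -> V),
    monoid_hom (free_monoid P) D f /\ set_bij (free_monoid P) D f.
Proof.
move=> [subD [P [f fbij fD]]]; exists P, f; split=> //.
have F0 : free_monoid P 0 by case: (submonoid_free P).
split=> //; first exact: submonoid_free.
  by move=> x Fx; case: fbij => fun_f _ _; apply: fun_f.
by apply: (addIr (f 0)); rewrite -fD // addr0 add0r.
Qed.

(** In the free monoid, m v divides m u only if v divides u; a divisor
    homomorphism pulls this back, so Krull monoids are root-closed. *)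
Lemma Krull_root (V : zmodType) (H : set V) a b m : Krull H ->
  H a -> H b -> (0 < m)%N -> H ((a - b) *+ m) -> H (a - b).
Proof.
move=> [W [D [phi [/free_abelian_hom [P [f [homf [_ injf surjf]]]]]]]].
move=> [homphi phi_div] Ha Hb m_gt0 Hm.
have [subH subD phiD phi0 phiA] := homphi; have [subF _ _ _ fA] := homf.
have [[u Fu eu] [v Fv ev] [w Fw ew]] := And3 (surjf _ (phiD _ Ha))
  (surjf _ (phiD _ Hb)) (surjf _ (phiD _ Hm)).
have e : w + v *+ m = u *+ m.
  apply: injf; rewrite ?inE; [| exact: submonoidMn |].
    by apply: (submonoid_free P).2 => //; apply: submonoidMn.
  rewrite fA ?(monoid_homMn _ homf) //; last exact: submonoidMn.
  rewrite eu ev ew -!(monoid_homMn _ homphi) // -phiA //; last exact: submonoidMn.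
  by rewrite mulrnBl subrK.
have /mdivides_freeP [t Ft et] : forall p, coeff p v <= coeff p u.
  move=> p; rewrite -(ler_pMn2r m_gt0) -!coeffMn -e coeffD lerDr.
  by move: p; apply/freeP.
have [|c Hc ->] := phi_div b a Hb Ha; last by rewrite addrC addKr.
exists (f t); first by have [_ _ fF _ _] := homf; apply: fF.
by rewrite -eu -ev et fA.
Qed.

Lemma munitsD (V : zmodType) (H : set V) x y : submonoid H ->
  munits H x -> munits H y -> munits H (x + y).
Proof.
by move=> [_ HD] [Hx HNx] [Hy HNy]; split; rewrite ?opprD; apply: HD.
Qed.

Lemma munitsMn (V : zmodType) (H : set V) x n : submonoid H -> (0 < n)%N ->
  H x -> (munits H (x *+ n) <-> munits H x).
Proof.
move=> subH n_gt0 Hx; split=> [[_ HN] | [_ HN]]; split=> //.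
- have -> : - x = x *+ n.-1 + - (x *+ n).
    by rewrite -{2}(prednK n_gt0) mulrS opprD addrCA subrr addr0.
  by apply: subH.2 => //; apply: submonoidMn.
- exact: submonoidMn.
- by rewrite -mulNrn; apply: submonoidMn.
Qed.

Lemma munits_massociated (V : zmodType) (H : set V) x y : submonoid H ->
  massociated H x y -> munits H x -> munits H y.
Proof.
move=> subH exy Ux; have : addcoset y (munits H) y.
  by exists 0; rewrite ?addr0 //; split; rewrite ?oppr0; case: subH.
by rewrite -exy => -[u Uu <-]; apply: munitsD.
Qed.

(** Put z = theta (x + t) - theta t. Then m z = theta (m x) lies in the Krull
    monoid, which is root-closed, so z lies in it too. Hence theta (m x) is a
    sum of m >= 2 copies of a non-unit, and (T2) lifts the splitting
    z + (m - 1) z to a proper splitting of m x in H. *)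
Lemma transfer_Krull_atom (V : zmodType) (H : set V) x t m :
  transfer_Krull H -> H t -> H (x + t) -> (1 < m)%N -> ~ atom H (x *+ m).
Proof.
move=> [W [D [theta [KrD [homt _ unitt T2]]]]] Ht Hxt m_gt1 [Hm NUm atomm].
have [subH subD thetaD theta0 thetaA] := homt.
pose z := theta (x + t) - theta t.
have ez : z *+ m = theta (x *+ m).
  rewrite mulrnBl -!(monoid_homMn _ homt) // mulrnDl thetaA ?addrK //.
  exact: submonoidMn.
have m_gt0 : (0 < m)%N by apply: ltnW.
have Dz : D z.
  by apply: (Krull_root KrD _ _ m_gt0); [exact: thetaD.. | rewrite ez; apply: thetaD].
have NUz : ~ munits D z.
  by move=> Uz; apply: NUm; apply/unitt => //; rewrite -ez; apply/munitsMn.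
have Dz' : D (z *+ m.-1) by apply: submonoidMn.
have [|v [w [Hv Hw evw vz wz]]] := T2 (x *+ m) z (z *+ m.-1) Hm Dz Dz'.
  by rewrite -ez -mulrS prednK.
case: (atomm v w Hv Hw evw) => [/(unitt _ Hv) | /(unitt _ Hw)].
  by move/(munits_massociated subD vz).
move=> /(munits_massociated subD wz) Uz; apply: NUz.
by apply/(munitsMn (n := m.-1) subD); rewrite // -subn1 subn_gt0.
Qed.

End KrullMonoids.

(** * Quotients of arbitrary groups *)

Local Open Scope quotient_scope.

Section QuotientGroup.
Variables (G : groupType) (K : set G) (normalK : normal_subgroup K).

(** K is a Prop-valued set, hence the boolean reflection: generic quotients
    need a boolean equivalence. *)
Definition coset_rel : rel G := fun x y => `[< K (x^-1 * y)%g >].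

Lemma coset_rel_equiv : equiv_class_of coset_rel.
Proof.
have [[K1 KM KV] KJ] := normalK; split=> [x | x y | y x z].
- by apply/asboolP; rewrite mulVg.
- by apply/asboolP/asboolP => /KV; rewrite invgM invgK.
- move=> /asboolP Kxy /asboolP Kyz; apply/asboolP.
  by rewrite -(mulgK y (x^-1)%g) -mulgA; apply: KM.
Qed.

Canonical coset_equiv := EquivRelPack coset_rel_equiv.
Definition coset_group := {eq_quot coset_equiv}.
HB.instance Definition _ := Choice.on coset_group.
HB.instance Definition _ : EqQuotient G coset_equiv coset_group :=
  EqQuotient.on coset_group.

Definition coset_pi (x : G) : coset_group := \pi_coset_group x.

Lemma coset_piP x y : coset_pi x = coset_pi y <-> K (x^-1 * y)%g.
Proof. by split=> [/eqmodP /asboolP | Kxy]; last by apply/eqmodP/asboolP. Qed.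

Lemma coset_piK (u : coset_group) : coset_pi (repr u) = u.
Proof. exact: reprK. Qed.

Definition coset_one : coset_group := coset_pi 1%g.
Definition coset_inv (u : coset_group) : coset_group := coset_pi (repr u)^-1%g.
Definition coset_mul (u v : coset_group) : coset_group := coset_pi (repr u * repr v)%g.

Lemma coset_piM x y : coset_pi (x * y)%g = coset_mul (coset_pi x) (coset_pi y).
Proof.
have [[K1 KM KV] KJ] := normalK; apply/coset_piP.
set x' := repr (coset_pi x); set y' := repr (coset_pi y).
have /coset_piP Kx : coset_pi x = coset_pi x' by rewrite coset_piK.
have /coset_piP Ky : coset_pi y = coset_pi y' by rewrite coset_piK.
have -> : ((x * y)^-1 * (x' * y') = (x^-1 * x') ^ y * (y^-1 * y'))%g.
  by rewrite conjgE invgM !mulgA mulgK.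
by apply: KM => //; apply: KJ.
Qed.

Lemma coset_piV x : coset_pi x^-1%g = coset_inv (coset_pi x).
Proof.
have [[K1 KM KV] KJ] := normalK; apply/coset_piP.
set x' := repr (coset_pi x).
have /coset_piP Kx : coset_pi x' = coset_pi x by rewrite coset_piK.
rewrite invgK -[x in (x * _)%g](mulVKg x') -mulgA -{1}[x']invgK -conjgE.
exact: KJ.
Qed.

Lemma coset_mulA : associative coset_mul.
Proof.
by move=> u v w; rewrite -[u]coset_piK -[v]coset_piK -[w]coset_piK -!coset_piM mulgA.
Qed.
Lemma coset_mul1 : left_id coset_one coset_mul.
Proof. by move=> u; rewrite -[u]coset_piK -coset_piM mul1g. Qed.
Lemma coset_mulg1 : right_id coset_one coset_mul.
Proof. by move=> u; rewrite -[u]coset_piK -coset_piM mulg1. Qed.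
Lemma coset_mulV : left_inverse coset_one coset_inv coset_mul.
Proof. by move=> u; rewrite -[u]coset_piK -coset_piV -coset_piM mulVg. Qed.
Lemma coset_mulgV : right_inverse coset_one coset_inv coset_mul.
Proof. by move=> u; rewrite -[u]coset_piK -coset_piV -coset_piM mulgV. Qed.

HB.instance Definition _ := isGroup.Build coset_group
  coset_mulA coset_mul1 coset_mulg1 coset_mulV coset_mulgV.
HB.instance Definition _ := isMultiplicative.Build G coset_group coset_pi coset_piM.
HB.instance Definition _ :=
  Multiplicative_isUMagmaMorphism.Build G coset_group coset_pi erefl.

End QuotientGroup.

(** Membership in K becomes an equation in an honest group, in which products can
    be computed by rewriting. *)
Lemma quotient_morphism (G : groupType) (K : set G) : normal_subgroup K ->
  exists (Q : groupType) (f : UMagmaMorphism.type G Q),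
    (forall u, exists x, f x = u) /\ (forall x, K x <-> f x = 1%g).
Proof.
move=> nK; exists (coset_group nK), (@coset_pi G K nK).
split=> [u|x]; first by exists (repr u); apply: coset_piK.
split=> [Kx | /esym/coset_piP]; last by rewrite invg1 mul1g.
by apply/esym/coset_piP; rewrite invg1 mul1g.
Qed.

(** * Products of sequences over a group *)

Notation prodg s := (\prod_(g <- s) g)%g.

Notation inv_seq s := [seq (x^-1)%g | x <- rev s].

Lemma prodg_nseq (G : groupType) n (x : G) : prodg (nseq n x) = (x ^+ n)%g.
Proof. by elim: n => [|n IHn]; rewrite ?big_nil //= big_cons IHn expgS. Qed.

Lemma prodg_map (G Q : groupType) (f : UMagmaMorphism.type G Q) s :
  f (prodg s) = prodg (map f s).
Proof. by rewrite gmulf_prod big_map. Qed.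

Lemma prodg_perm (Q : groupType) (u v : seq Q) :
  (forall x y : Q, commute x y) -> perm_eq u v -> prodg u = prodg v.
Proof.
move=> comQ; move: u v; apply: catCA_perm_subst => s1 s2 s3.
by rewrite !big_cat /= !mulgA (comQ (prodg s1)).
Qed.

(** A rearrangement of the images is induced by a rearrangement of the terms;
    this lets product monoids be studied in the quotient group. *)
Lemma perm_map_preimage (T U : eqType) (f : T -> U) s u :
  perm_eq (map f s) u -> exists2 t, perm_eq s t & map f t = u.
Proof.
case: s => [|x s]; first by rewrite perm_sym => /perm_nilP ->; exists [::].
rewrite perm_sym => /(perm_iotaP (f x)) [Is eIs ->].
exists [seq nth x (x :: s) i | i <- Is].
  by rewrite perm_sym; apply/(perm_iotaP x); exists Is; move: eIs; rewrite ?size_map.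
rewrite -map_comp; apply/eq_in_map => i; rewrite (perm_mem eIs) mem_iota /=.
by move=> lti /=; rewrite -map_cons (nth_map x) // -(size_map f).
Qed.

Section ProductMonoid.
Variable G : groupType.
Implicit Types (K L : set G) (s t : seq G).

Lemma subgroupX K n x : subgroup K -> K x -> K (x ^+ n)%g.
Proof.
by move=> [K1 KM _] Kx; elim: n => [|n IHn]; rewrite ?expgS ?expg0 //; apply: KM.
Qed.

Lemma product_monoidP K s :
  product_monoid K (seq_sum s) <-> exists2 t, perm_eq s t & K (prodg t).
Proof.
split=> [[_ [_ [[t /esym/seq_sumP est <-] Kt]]] | [t est Kt]]; first by exists t.
split; first by exists s.
by exists (prodg t); split=> //; exists t => //; apply/esym/seq_sumP.
Qed.

Lemma product_monoid_list K s : K (prodg s) -> product_monoid K (seq_sum s).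
Proof. by move=> Ks; apply/product_monoidP; exists s. Qed.

Lemma product_monoid_sub K : product_monoid K `<=` free_monoid G.
Proof. by move=> x []. Qed.

Lemma submonoid_product_monoid K : subgroup K -> submonoid (product_monoid K).
Proof.
move=> [K1 KM KV]; split.
  by rewrite -seq_sum_nil; apply: product_monoid_list; rewrite big_nil.
move=> _ _ /[dup] /product_monoid_sub [s _ <-] /product_monoidP [s' es Ks]
  /[dup] /product_monoid_sub [t _ <-] /product_monoidP [t' et Kt].
rewrite -seq_sum_cat; apply/product_monoidP; exists (s' ++ t').
  exact: perm_cat.
by rewrite big_cat; apply: KM.
Qed.

Lemma product_monoidS K L : K `<=` L -> product_monoid K `<=` product_monoid L.
Proof.
move=> KL _ /[dup] /product_monoid_sub [s _ <-] /product_monoidP [t est /KL Lt].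
by apply/product_monoidP; exists t.
Qed.

Lemma prodg_flatten_nseq n s : prodg (flatten (nseq n s)) = (prodg s ^+ n)%g.
Proof. by elim: n => [|n IHn]; rewrite ?big_nil //= big_cat /= IHn expgS. Qed.

Lemma seq_sum_flatten_nseq n s : seq_sum (flatten (nseq n s)) = seq_sum s *+ n.
Proof.
elim: n => [|n IHn]; first by rewrite seq_sum_nil mulr0n.
by rewrite /= seq_sum_cat IHn mulrS.
Qed.

Lemma product_monoidX K s n :
  K (prodg s ^+ n)%g -> product_monoid K (seq_sum s *+ n).
Proof.
by rewrite -prodg_flatten_nseq -seq_sum_flatten_nseq; apply: product_monoid_list.
Qed.

Lemma product_monoid_torsion K S : torsion_quotient K -> free_monoid G S ->
  exists2 n, (0 < n)%N & product_monoid K (S *+ n).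
Proof.
move=> torK [s _ <-]; have [n n_gt0 Kn] := torK (prodg s).
by exists n => //; apply: product_monoidX.
Qed.

Lemma prodg_inv s : prodg (inv_seq s) = (prodg s)^-1%g.
Proof. by elim: s => [|x s IHs]; rewrite ?big_nil ?invg1 // rev_cons map_rcons
  -cats1 big_cat IHs big_seq1 big_cons invgM. Qed.

End ProductMonoid.

(** * Products modulo a subgroup containing the commutators *)

Section AbelianQuotient.
Variables (G : groupType) (N : set G) (normalN : normal_subgroup N).
Hypothesis derN : commutator_subgroup G `<=` N.

(** Modulo a normal subgroup containing all commutators, the product of a
    sequence depends only on the sequence and not on the order of its terms. *)
Lemma abelian_quotient_morphism :
  exists (Q : groupType) (f : UMagmaMorphism.type G Q), [/\
    forall u, exists x, f x = u, forall x, N x <-> f x = 1%g &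
    forall s t, perm_eq s t -> f (prodg s) = f (prodg t)].
Proof.
have [Q [f [surjf kerf]]] := quotient_morphism normalN.
exists Q, f; split=> // s t est; rewrite !prodg_map; apply: prodg_perm (perm_map _ est).
move=> u v; have [x <-] := surjf u; have [y <-] := surjf v.
apply/commgP/eqP; rewrite -gmulfR; apply/kerf/derN.
by apply: sub_gen_smallest; exists x => //; exists y.
Qed.

Lemma product_monoid_abelianP s : product_monoid N (seq_sum s) <-> N (prodg s).
Proof.
have [Q [f [surjf kerf permf]]] := abelian_quotient_morphism.
split=> [/product_monoidP [t /permf est /kerf Nt] | ]; last exact: product_monoid_list.
by apply/kerf; rewrite est.
Qed.

(** Since the class of the product is additive on sequences, the class of y is
    trivial as soon as those of x and x + y are. *)
Lemma product_monoid_divisor_closed x y : product_monoid N x ->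
  free_monoid G y -> (product_monoid N (x + y) <-> product_monoid N y).
Proof.
move=> Bx Fy; split; last first.
  by move=> By; apply: (submonoid_product_monoid normalN.1).2.
case/product_monoid_sub: (Bx) => s _ es; move: Bx; rewrite -{}es.
case: Fy => t _ <- /product_monoid_abelianP /[swap].
have [Q [f [surjf kerf permf]]] := abelian_quotient_morphism.
rewrite -seq_sum_cat !product_monoid_abelianP big_cat /= !kerf gmulfM => est es.
by rewrite -est es mul1g.
Qed.

Lemma product_monoid_divisor_hom : divisor_hom (product_monoid N) (free_monoid G) id.
Proof.
have subN := submonoid_product_monoid normalN.1; split.
  exact: (sub_free_monoid_hom subN (@product_monoid_sub _ _)).
move=> a b Ba Bb [c Fc eb]; exists c => //.
by apply/(product_monoid_divisor_closed Ba Fc); rewrite -eb.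
Qed.

(** If the products agree modulo N, appending to s and to t the inverses of the
    terms of t puts both sequences in the product monoid. *)
Lemma quotient_group_abelianP s t :
  quotient_group (product_monoid N) (seq_sum s - seq_sum t) <->
  N ((prodg s)^-1 * prodg t)%g.
Proof.
have [Q [f [surjf kerf permf]]] := abelian_quotient_morphism.
rewrite kerf gmulfM gmulfV; split.
  move=> [_ /[dup] /product_monoid_sub [u _ <-] /product_monoid_abelianP /kerf fu]
    [_ /[dup] /product_monoid_sub [v _ <-] /product_monoid_abelianP /kerf fv].
  move=> /(canRL (subrK _)) e.
  have: f (prodg (u ++ t)) = f (prodg (s ++ v)).
    by apply/permf/seq_sumP; rewrite !seq_sum_cat e addrAC subrK.
  by rewrite !big_cat /= !gmulfM fu fv mul1g mulg1 => ->; rewrite mulVg.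
move=> fst; have {}fst : f (prodg s) = f (prodg t).
  by apply/esym/(mulgI (f (prodg s))^-1%g); rewrite fst mulVg.
pose t' := inv_seq t; exists (seq_sum (s ++ t')); last first.
  exists (seq_sum (t ++ t')); last by rewrite !seq_sum_cat opprD addrACA subrr addr0.
  by apply: product_monoid_list; rewrite big_cat /= prodg_inv mulgV; case: normalN => -[].
apply: product_monoid_list; apply/kerf.
by rewrite big_cat /= prodg_inv gmulfM gmulfV fst mulgV.
Qed.

End AbelianQuotient.

(** * Rearranging sequences to realize commutators *)

Section Commutators.
Variable G : groupType.
Implicit Types (K : set G) (s t : seq G).

Lemma subgroup_commutators : subgroup (commutator_subgroup G).
Proof.
split=> [X [[]] // | x y Gx Gy X XG | x Gx X XG].
  by case: (XG) => -[_ XM _] _; apply: XM; [apply: Gx | apply: Gy].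
by case: (XG) => -[_ _ XV] _; apply: XV; apply: Gx.
Qed.

Lemma commutator_in x y : commutator_subgroup G [~ x, y]%g.
Proof. by apply: sub_gen_smallest; exists x => //; exists y. Qed.

Lemma commutator_subgroup_sub K : subgroup K ->
  (forall x y, K [~ x, y]%g) -> commutator_subgroup G `<=` K.
Proof. by move=> sK KR; apply: smallest_sub => // _ [x _ [y _ <-]]. Qed.

Lemma abelian_commutators_sub K : subgroup K ->
  (forall x y : G, commute x y) -> commutator_subgroup G `<=` K.
Proof.
move=> sK comG; apply: commutator_subgroup_sub => // x y.
by have /commgP/eqP -> := comG x y; case: sK.
Qed.

(** The four terms x^-1, x, y^-1, y multiply to 1 or to [~ x, y], according to
    their order. The elements w for which such a sequence exists form a subgroup:
    concatenate for products, invert and reverse for inverses. *)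
Lemma commutator_rearrangement w : commutator_subgroup G w ->
  exists s t, [/\ perm_eq s t, prodg s = 1%g & prodg t = w].
Proof.
apply: (@smallest_sub _ _ _ [set w | exists s t,
    [/\ perm_eq s t, prodg s = 1%g & prodg t = w]]).
  split.
  - by exists [::], [::]; rewrite big_nil.
  - move=> x y [s [t [est s1 tx]]] [s' [t' [est' s1' ty]]].
    exists (s ++ s'), (t ++ t'); rewrite !big_cat /= s1 s1' tx ty mul1g.
    by split=> //; apply: perm_cat.
  - move=> x [s [t [est s1 tx]]]; exists (inv_seq s), (inv_seq t).
    rewrite !prodg_inv s1 tx invg1; split=> //.
    by rewrite perm_map // perm_rev perm_sym perm_rev perm_sym.
move=> _ [x _ [y _ <-]].
exists [:: x^-1; x; y^-1; y]%g, [:: x^-1; y^-1; x; y]%g; split.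
- by rewrite perm_cons; apply/permPl/(perm_catCA [:: x] [:: y^-1]%g [:: y]).
- by rewrite !big_cons big_nil mulg1 mulKg mulVg.
- by rewrite !big_cons big_nil mulg1.
Qed.

(** Each occurrence of g is replaced by the two terms u and u^-1 * g; neither is
    g, and no product changes. *)
Lemma commutator_rearrangement_avoiding g u w : u <> 1%g -> u <> g ->
  commutator_subgroup G w ->
  exists s t, [/\ perm_eq s t, prodg s = 1%g, prodg t = w & g \notin s].
Proof.
move=> u1 ug /commutator_rearrangement [s [t [est s1 tw]]].
(* The factor u^-1 * g differs from g because u is not 1. *)
pose h x := if x == g then [:: u; u^-1 * g]%g else [:: x].
have prodh r : prodg (flatten (map h r)) = prodg r.
  elim: r => [|x r IHr]; rewrite ?big_nil //= big_cat /= IHr big_cons /h.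
  case: (eqVneq x g) => [->|_]; last by rewrite big_seq1.
  by rewrite !big_cons big_nil mulg1 mulVKg.
exists (flatten (map h s)), (flatten (map h t)); split; rewrite ?prodh //.
  by rewrite perm_flatten // perm_map.
apply/flatten_mapP => -[x _]; rewrite /h; case: (eqVneq x g) => [_|xg]; last first.
  by rewrite inE eq_sym (negbTE xg).
rewrite !inE eq_sym => /orP [/eqP // | /eqP e].
by apply: u1; apply: (mulIg (u^-1 * g)%g); rewrite mulVKg mul1g.
Qed.

Section KG'.
Variables (K : set G) (normalK : normal_subgroup K).
Notation N := (mulset K (commutator_subgroup G)).

Lemma sub_mulset_commutators : K `<=` N.
Proof.
have [D1 _ _] := subgroup_commutators.
by move=> x Kx; exists x => //; exists 1%g => //; rewrite mulg1.
Qed.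

Lemma commutators_sub_mulset : commutator_subgroup G `<=` N.
Proof.
have [[K1 _ _] _] := normalK.
by move=> x Gx; exists 1%g => //; exists x => //; rewrite mul1g.
Qed.

Lemma normal_mulset_commutators : normal_subgroup N.
Proof.
have [D1 DM DV] := subgroup_commutators; have [[K1 KM KV] KJ] := normalK.
have NM x y : N x -> N y -> N (x * y)%g.
  move=> [a Ka [b Db <-]] [c Kc [d Dd <-]]; exists (a * c ^ b^-1)%g.
    by apply: KM => //; apply: KJ.
  by exists (b * d)%g; [exact: DM | rewrite conjgE invgK !mulgA mulgVK].
split; first split=> //.
- by apply: sub_mulset_commutators.
- move=> _ [a Ka [b Db <-]]; rewrite invgM.
  apply: NM; first by apply: commutators_sub_mulset; apply: DV.
  by apply: sub_mulset_commutators; apply: KV.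
- move=> x g Nx; have -> : (x ^ g = x * [~ x, g])%g by rewrite commgEl mulVKg.
  by apply: NM => //; apply: commutators_sub_mulset; apply: commutator_in.
Qed.

Lemma mulset_commutators_id : commutator_subgroup G `<=` K -> N = K.
Proof.
have [[K1 KM KV] KJ] := normalK.
move=> DK; apply/seteqP; split; last exact: sub_mulset_commutators.
by move=> _ [a Ka [b /DK Kb <-]]; apply: KM.
Qed.

(** If prodg s = k * w with w in G', adjoin a sequence t with products 1 and
    w^-1: one order of t shows that t has a product in K, the other one that
    s ++ t has. *)
Lemma mulset_commutators_rearrangement s : N (prodg s) ->
  exists2 t, product_monoid K (seq_sum t) & product_monoid K (seq_sum (s ++ t)).
Proof.
have [[K1 KM KV] KJ] := normalK.
move=> [k Kk [w Gw ekw]]; have Gw' : commutator_subgroup G w^-1%g.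
  by case: subgroup_commutators => _ _; apply.
have [t [t' [ett t1 t'w]]] := commutator_rearrangement Gw'.
exists t; first by apply: product_monoid_list; rewrite t1.
apply/product_monoidP; exists (s ++ t'); first by rewrite perm_cat2l.
by rewrite big_cat /= t'w -ekw mulgK.
Qed.

End KG'.
End Commutators.

(** * Root closure and complete integral closure *)

Section IntegralClosures.
Variables (G : groupType) (K : set G).
Variables (normalK : normal_subgroup K) (torsionK : torsion_quotient K).
Notation N := (mulset K (commutator_subgroup G)).
Notation B := (product_monoid K).

Let normalN := normal_mulset_commutators normalK.
Let derN : commutator_subgroup G `<=` N := @commutators_sub_mulset G K normalK.
Let subB : submonoid B := submonoid_product_monoid normalK.1.

Lemma product_monoid_sub_mulset : B `<=` product_monoid N.
Proof. exact/product_monoidS/sub_mulset_commutators. Qed.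

Lemma product_monoid_mulset_quotient : product_monoid N `<=` quotient_group B.
Proof.
move=> _ /[dup] /product_monoid_sub [s _ <-] /product_monoid_abelianP Ns.
have [t Bt Bst] := mulset_commutators_rearrangement normalK (Ns normalN derN).
exists (seq_sum (s ++ t)) => //; exists (seq_sum t) => //.
by rewrite seq_sum_cat addrK.
Qed.

Lemma quotient_group_product_monoid :
  quotient_group (product_monoid N) = quotient_group B.
Proof.
exact: (quotient_group_between subB product_monoid_sub_mulset product_monoid_mulset_quotient).
Qed.

(** The quotient G/K is torsion, so some power of every sequence with product in
    KG' has its product in K. *)
Lemma root_closure_product_monoid : root_closure B = product_monoid N.
Proof.
apply/seteqP; split=> [x [Qx [n n_gt0 Bnx]] | x Nx]; last first.
  split; first exact: product_monoid_mulset_quotient.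
  exact: (product_monoid_torsion torsionK (product_monoid_sub Nx)).
have Fx : free_monoid G x.
  apply/freeP => p; have /freeP /(_ p) := product_monoid_sub Bnx.
  by rewrite coeffMn pmulrn_lge0.
move: Qx => [a Ba [b Bb exab]].
apply/(product_monoid_divisor_closed normalN derN (product_monoid_sub_mulset Bb) Fx).
by rewrite -exab addrC subrK; apply: product_monoid_sub_mulset.
Qed.

(** For a sequence s with product in KG', choose t such that t and s ++ t have
    products in K, and m with m s in B. Then c = m t works: write n = q m + r
    with r < m, so that c + n s = q (m s) + r (s + t) + (m - r) t.
    Conversely c + n x is a sequence for all n only if no coefficient of x is
    negative. *)
Lemma complete_integral_closure_product_monoid :
  complete_integral_closure B = product_monoid N.
Proof.
apply/seteqP; split=> [x [Qx [c Bc Bcx]] | x Nx]; last first.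
  split; first exact: product_monoid_mulset_quotient.
  case/product_monoid_sub: (Nx) => s _ es; move: Nx; rewrite -{}es.
  move=> /(product_monoid_abelianP normalN derN) Ns.
  have [t Bt Bst] := mulset_commutators_rearrangement normalK Ns.
  have [m m_gt0 Bm] : exists2 m, (0 < m)%N & B (seq_sum s *+ m).
    by apply: product_monoid_torsion => //; exists s.
  exists (seq_sum t *+ m) => [|n _]; first exact: submonoidMn.
  have le_rm : (n %% m <= m)%N by rewrite ltnW // ltn_mod.
  have -> : seq_sum t *+ m + seq_sum s *+ n = seq_sum s *+ m *+ (n %/ m) +
      (seq_sum (s ++ t) *+ (n %% m) + seq_sum t *+ (m - n %% m)).
    rewrite seq_sum_cat mulrnDl -[in RHS]addrA -[in RHS]mulrnDr subnKC // -mulrnA.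
    by rewrite addrA -mulrnDr mulnC -divn_eq addrC.
  by do 2?[apply: subB.2]; apply: submonoidMn.
have Fx : free_monoid G x.
  apply/freeP => p; rewrite leNgt; apply/negP => x_lt0.
  have /freeP /(_ p) c_ge0 := product_monoid_sub Bc.
  have [n ec] : exists n, coeff p c = n%:Z.
    by case: (coeff p c) c_ge0 => // n _; exists n.
  have /freeP /(_ p) := product_monoid_sub (Bcx n.+1 isT).
  rewrite coeffD coeffMn ec -mulr_natr natz => ge0.
  by move: (coeff p x) x_lt0 ge0 => y y_lt0; nia.
move: Qx => [a Ba [b Bb exab]].
apply/(product_monoid_divisor_closed normalN derN (product_monoid_sub_mulset Bb) Fx).
by rewrite -exab addrC subrK; apply: product_monoid_sub_mulset.
Qed.

End IntegralClosures.

(** * Cosets, residue classes and the class semigroup *)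

Lemma prodg1 (G : groupType) (g : G) : prodg [:: g] = g.
Proof. exact: big_seq1. Qed.

Section Cosets.
Variables (G : groupType) (N : set G) (normalN : normal_subgroup N).

Lemma mem_cosetP x z : mulset [set x] N z <-> N (x^-1 * z)%g.
Proof.
split=> [[_ -> [n Nn <-]] | Nxz]; first by rewrite mulKg.
by exists x => //; exists (x^-1 * z)%g => //; rewrite mulVKg.
Qed.

Lemma coset_eq x y : mulset [set x] N = mulset [set y] N <-> N (x^-1 * y)%g.
Proof.
have [[N1 NM NV] NJ] := normalN; split=> [exy | Nxy].
  by apply/mem_cosetP; rewrite exy; apply/mem_cosetP; rewrite mulVg.
apply/seteqP; split=> z /mem_cosetP Nz; apply/mem_cosetP.
  have -> : (y^-1 * z = (x^-1 * y)^-1 * (x^-1 * z))%g by rewrite invgM invgK mulgA mulgK.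
  by apply: NM => //; apply: NV.
have -> : (x^-1 * z = (x^-1 * y) * (y^-1 * z))%g by rewrite mulgA mulgK.
by apply: NM.
Qed.

Lemma coset_mul_coset x y :
  mulset (mulset [set x] N) (mulset [set y] N) = mulset [set (x * y)%g] N.
Proof.
have [[N1 NM NV] NJ] := normalN.
apply/seteqP; split=> [_ [a /mem_cosetP Na [b /mem_cosetP Nb <-]] | z /mem_cosetP Nz].
  apply/mem_cosetP; have -> : ((x * y)^-1 * (a * b) = (x^-1 * a) ^ y * (y^-1 * b))%g.
    by rewrite conjgE invgM !mulgA mulgK.
  by apply: NM => //; apply: NJ.
exists x; first by apply/mem_cosetP; rewrite mulVg.
exists (x^-1 * z)%g; last by rewrite mulVKg.
by apply/mem_cosetP; rewrite mulgA -invgM.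
Qed.

Lemma coset_card x : mulset [set x] N #= N.
Proof.
have -> : mulset [set x] N = [set (x * n)%g | n in N].
  apply/seteqP; split=> [_ [_ -> [n Nn <-]] | _ [n Nn <-]]; first by exists n.
  by exists x => //; exists n.
by apply: inj_card_eq => a b _ _; apply: mulgI.
Qed.

(** Both the residue classes and the class semigroup are quotients of the monoid
    of sequences by the relation of having products in the same coset of N, so
    both isomorphisms with G/N are instances of this lemma. The value at C is
    the coset of the product of any sequence of class C. *)
Lemma quotient_isomorphic (T : Type) (op : T -> T -> T) (cls : seq G -> T) :
  (forall s t, cls s = cls t <-> N ((prodg s)^-1 * prodg t)%g) ->
  (forall s t, op (cls s) (cls t) = cls (s ++ t)) ->
  magma_isomorphic (range cls) op (quotient N) (@mulset G).
Proof.
move=> clsE clsM.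
pose rep C := xget [::] [set s | cls s = C].
have repE s : mulset [set prodg (rep (cls s))] N = mulset [set prodg s] N.
  by apply/coset_eq/clsE; apply: (@xgetI _ _ [set t | cls t = cls s] s).
exists (fun C => mulset [set prodg (rep C)] N); first split.
- by move=> _ [s _ <-]; exists (prodg (rep (cls s))).
- by move=> _ _ /set_mem [s _ <-] /set_mem [t _ <-]; rewrite !repE => /coset_eq /clsE.
- move=> _ [g _ <-]; exists (cls [:: g]); first by exists [:: g].
  by rewrite repE big_seq1.
move=> _ _ [s _ <-] [t _ <-].
by rewrite clsM !repE coset_mul_coset big_cat.
Qed.

End Cosets.

Section Residues.
Variables (G : groupType) (K : set G) (normalK : normal_subgroup K).
Notation N := (mulset K (commutator_subgroup G)).
Notation B := (product_monoid K).

Let normalN := normal_mulset_commutators normalK.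
Let derN : commutator_subgroup G `<=` N := @commutators_sub_mulset G K normalK.
Let subB : submonoid B := submonoid_product_monoid normalK.1.

Definition residue s := addcoset (seq_sum s) (quotient_group B).

Lemma residue_classesE : residue_classes K = range residue.
Proof. by rewrite /residue_classes /free_monoid image_comp. Qed.

Lemma residue_eq s t : residue s = residue t <-> N ((prodg s)^-1 * prodg t)%g.
Proof.
rewrite /residue addcoset_eq // -(quotient_group_abelianP normalN derN).
by rewrite quotient_group_product_monoid.
Qed.

Lemma residue_classes_isomorphic :
  magma_isomorphic (residue_classes K) (@addset _) (quotient N) (@mulset G).
Proof.
rewrite residue_classesE; apply: quotient_isomorphic => // s t.
  exact: residue_eq.
by rewrite /residue addset_addcoset // seq_sum_cat.
Qed.

(** The terms g whose class is C are the elements of a single coset of KG'. *)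
Lemma residue_prime_divisors C : residue_classes K C -> [set g | C << g >>] #= N.
Proof.
rewrite residue_classesE => -[s _ <-]; set A := [set g | _].
suff -> : A = mulset [set prodg s] N by apply: coset_card.
apply/seteqP; split=> g.
  move=> [z Qz e]; apply/mem_cosetP; rewrite -(prodg1 g).
  apply/residue_eq/addcoset_eq => //; rewrite seq_sum1 -e opprD addrA subrr add0r.
  exact: quotient_groupN.
move=> /mem_cosetP; rewrite -(prodg1 g) => /residue_eq e.
rewrite /A /= -/(residue s) e; exists 0; first by case: (quotient_group_submonoid subB).
by rewrite prodg1 seq_sum1 addr0.
Qed.

(** The difference of sequences s - t has the same class as the sequence obtained
    from s by appending the inverses of the terms of t. *)
Lemma class_group_residue_classes :
  class_group (product_monoid N) (free_monoid G) id = residue_classes K.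
Proof.
rewrite /class_group image_id quotient_group_product_monoid //.
apply/seteqP; split=> _ [x Fx <-]; last first.
  by exists x => //; apply: quotient_group_id => //; exact: submonoid_free.
case: Fx => _ [s _ <-] [_ [t _ <-] <-].
exists (seq_sum (s ++ inv_seq t)); first by exists (s ++ inv_seq t).
apply/addcoset_eq => //; rewrite seq_sum_cat opprB addrC addrA subrK.
apply: quotient_group_id => //.
rewrite -seq_sum_cat; apply: product_monoid_list.
by rewrite big_cat /= prodg_inv mulgV; case: normalK => -[].
Qed.

End Residues.

Section ClassSemigroup.
Variables (G : groupType) (K : set G) (normalK : normal_subgroup K).
Hypothesis derK : commutator_subgroup G `<=` K.
Notation B := (product_monoid K).
Notation F := (free_monoid G).

Definition sequence_class s := class_of B F (seq_sum s).

Lemma class_of_eq (V : zmodType) (H D : set V) x y : D x -> D y ->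
  class_of H D x = class_of H D y <-> class_equiv H D x y.
Proof.
move=> Dx Dy; split=> [exy | exy].
  by have [] : class_of H D x y by rewrite exy; split.
apply/seteqP; split=> z [Dz ez]; split=> // w Dw.
  by rewrite -exy // ez.
by rewrite exy // ez.
Qed.

Lemma class_semigroupE : class_semigroup B F = range sequence_class.
Proof. by rewrite /class_semigroup /free_monoid image_comp. Qed.

Lemma sequence_classM s t :
  class_add B F (sequence_class s) (sequence_class t) = sequence_class (s ++ t).
Proof.
rewrite /sequence_class seq_sum_cat class_addE //; first exact: submonoid_free.
  by exists s.
by exists t.
Qed.

(** Testing the equivalence against the sequence of inverses of the terms of s
    shows that equivalent sequences have the same product modulo K. *)
Lemma sequence_class_eq s t :
  sequence_class s = sequence_class t <-> K ((prodg s)^-1 * prodg t)%g.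
Proof.
have [Q [f [surjf kerf permf]]] := abelian_quotient_morphism normalK derK.
rewrite class_of_eq; [|by exists s|by exists t].
rewrite kerf gmulfM gmulfV; split=> [est | fst].
  have /est : F (seq_sum (inv_seq s)) by exists (inv_seq s).
  rewrite -!seq_sum_cat !product_monoid_abelianP // !big_cat /= prodg_inv !kerf !gmulfM.
  rewrite gmulfV mulgV => /proj1 /(_ erefl) e.
  by rewrite (divg1_eq e) mulVg.
have {}fst : f (prodg s) = f (prodg t).
  by apply/esym/(mulgI (f (prodg s))^-1%g); rewrite fst mulVg.
move=> _ [u _ <-]; rewrite -!seq_sum_cat !product_monoid_abelianP //.
by rewrite !big_cat /= !kerf !gmulfM fst.
Qed.

Lemma class_semigroup_isomorphic :
  magma_isomorphic (class_semigroup B F) (class_add B F) (quotient K) (@mulset G).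
Proof.
rewrite class_semigroupE; apply: quotient_isomorphic => // s t.
  exact: sequence_class_eq.
exact: sequence_classM.
Qed.

Lemma class_semigroup_group : is_group (class_semigroup B F) (class_add B F).
Proof.
have K1 : K 1%g by case: normalK => -[].
rewrite class_semigroupE; split.
- by move=> _ _ [s _ <-] [t _ <-]; rewrite sequence_classM; exists (s ++ t).
- by move=> _ _ _ [s _ <-] [t _ <-] [u _ <-]; rewrite !sequence_classM catA.
exists (sequence_class [::]); first by exists [::].
split=> _ [s _ <-]; first by rewrite !sequence_classM cats0.
exists (sequence_class (inv_seq s)); first by exists (inv_seq s).
rewrite !sequence_classM; split; apply/sequence_class_eq;
  rewrite big_nil mulg1 big_cat /= prodg_inv.
  by rewrite mulgV invg1.
by rewrite mulVg invg1.
Qed.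

End ClassSemigroup.

(** * The divisor theory *)

Lemma two_elements_commute (G : groupType) (g : G) :
  (forall x, x = 1%g \/ x = g) -> forall x y : G, commute x y.
Proof.
move=> Gg x y; rewrite /commute.
by case: (Gg x) => ->; case: (Gg y) => ->; rewrite ?mul1g ?mulg1.
Qed.

Lemma two_elements (G : groupType) : [set: G] #= `I_2 ->
  exists g : G, forall x, x = 1%g \/ x = g.
Proof.
move=> /eq_cardSP [a _ /eq_cardSP [b _]]; rewrite II0 card_eq0 => /eqP eab.
have Gab x : x = a \/ x = b.
  apply: contrapT => /not_orP [xa xb].
  by have : (set0 : set G) x by rewrite -eab.
by case: (Gab 1%g) => e1; [exists b | exists a] => x; rewrite e1; case: (Gab x) => ->; auto.
Qed.

Section DivisorTheory.
Variable G : groupType.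

(** If prodg s is not in N, let h be its inverse and write h = u * v with u
    neither 1 nor h. Then s is the gcd of the two members s + h and s + u + v of
    the monoid, because h differs from both u and v. *)
Lemma divisor_theory_product_monoid (N : set G) : normal_subgroup N ->
  commutator_subgroup G `<=` N ->
  (forall h, ~ N h -> exists u, u <> 1%g /\ u <> h) ->
  divisor_theory (product_monoid N) (free_monoid G) id.
Proof.
move=> normalN derN third; have [[N1 NM NV] _] := normalN; split.
- exact: free_abelian_free.
- exact: product_monoid_divisor_hom.
move=> _ [s _ <-]; have Fs : free_monoid G (seq_sum s) by exists s.
have [Ns | NNs] := pselect (N (prodg s)).
  exists [:: seq_sum s].
    split=> // a; rewrite inE => /eqP ->.
    exact: product_monoid_list.
  split=> //; last by move=> y Fy; apply; exists (seq_sum s) => //=; rewrite inE.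
  by move=> _ [a /= + <-]; rewrite inE => /eqP ->; apply/mdivides_freeP.
set h := (prodg s)^-1%g; have NNh : ~ N h by move=> /NV; rewrite invgK.
have [u [u1 uh]] := third h NNh; set v := (u^-1 * h)%g.
have vh : v <> h.
  by move=> e; apply: u1; apply: (mulIg h); rewrite -{1}e mulVKg mul1g.
exists [:: seq_sum (s ++ [:: h]); seq_sum (s ++ [:: u; v])].
  split=> // a; rewrite !inE => /orP [] /eqP ->; apply: product_monoid_list.
    by rewrite big_cat /= big_seq1 mulgV.
  by rewrite big_cat /= !big_cons big_nil mulg1 mulVKg mulgV.
split=> //.
  move=> _ [a /= + <-]; rewrite !inE => /orP [] /eqP ->; rewrite seq_sum_cat.
    by exists (seq_sum [:: h]) => //; exists [:: h].
  by exists (seq_sum [:: u; v]) => //; exists [:: u; v].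
move=> y Fy ydiv; apply/mdivides_freeP => p.
have /mdivides_freeP /(_ p) : mdivides (free_monoid G) y (seq_sum (s ++ [:: h])).
  by apply: ydiv; exists (seq_sum (s ++ [:: h])) => //=; rewrite inE eqxx.
have /mdivides_freeP /(_ p) : mdivides (free_monoid G) y (seq_sum (s ++ [:: u; v])).
  by apply: ydiv; exists (seq_sum (s ++ [:: u; v])) => //=; rewrite !inE eqxx orbT.
rewrite !coeff_seq_sum !count_cat /= !addn0.
case: (eqVneq h p) => [<-|_]; last by rewrite addn0.
by move/eqP/negbTE: uh => ->; move/eqP/negbTE: vh => ->; rewrite addn0.
Qed.

(** Without a third element, G = {1, h} and K misses h, so that |G| = 2 and
    |K| = 1. *)
Lemma third_element (K : set G) h : subgroup K ->
  ~ ([set: G] #= `I_2 /\ K #= `I_1) -> ~ K h -> exists u, u <> 1%g /\ u <> h.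
Proof.
move=> [K1 _ _] nexc NKh; apply: contrapT => nu; apply: nexc.
have Gh u : u <> h -> u = 1%g.
  by move=> uh; apply: contrapT => u1; apply: nu; exists u.
have -> : K = [set 1%g].
  apply/seteqP; split=> [x Kx | _ -> //]; apply: Gh => xh.
  by apply: NKh; rewrite -xh.
split; last exact: card_set1.
apply/eq_cardSP; exists h => //.
have -> : [set: G] `\` [set h] = [set 1%g].
  apply/seteqP; split=> [x [_ /= /Gh //] | _ ->]; split=> //= h1.
  by apply: NKh; rewrite -h1.
exact: card_set1.
Qed.

End DivisorTheory.

(** * Minimal primes and weakly Krull monoids *)

Lemma product_monoid1 (G : groupType) (K : set G) g :
  product_monoid K << g >> <-> K g.
Proof.
rewrite -seq_sum1; split=> [/product_monoidP [t] | Kg].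
  by rewrite perm_sym => /perm_small_eq -> //; rewrite prodg1.
by apply: product_monoid_list; rewrite prodg1.
Qed.

Section MinimalPrimes.
Variables (G : groupType) (K : set G).
Variables (normalK : normal_subgroup K) (torsionK : torsion_quotient K).
Notation B := (product_monoid K).
Let subB : submonoid B := submonoid_product_monoid normalK.1.

Definition sequences_through g : set {freeg G} := [set S | B S /\ 0 < coeff g S].

Lemma coeff_ge0 g S : free_monoid G S -> 0 <= coeff g S.
Proof. by move=> /freeP. Qed.

Lemma sequences_through_prime g : prime_s_ideal B (sequences_through g).
Proof.
split; first split.
- by move=> x [].
- apply/seteqP; split=> [_ [a [Ba a_gt0] [b Bb <-]] | a [Ba a_gt0]].
    split; first exact: subB.2.
    by rewrite coeffD ltr_pwDl //; apply: coeff_ge0; apply: product_monoid_sub Bb.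
  by exists a => //; exists 0; [case: subB | rewrite addr0].
have cE S : (B `\` sequences_through g) S <-> B S /\ coeff g S = 0.
  split=> [[BS NgS] | [BS S0]]; split=> //; last first.
    by rewrite /sequences_through /= S0 ltxx => -[].
  apply/eqP; rewrite eq_le coeff_ge0 ?andbT; last exact: product_monoid_sub BS.
  by rewrite leNgt; apply/negP => gS; apply: NgS.
split; first by apply/cE; rewrite coeff0; case: subB.
move=> x y /cE [Bx x0] /cE [By y0]; apply/cE.
by rewrite coeffD x0 y0 addr0; split=> //; apply: subB.2.
Qed.

Lemma sequences_through_nonempty g :
  exists2 n, (0 < n)%N & sequences_through g (<< g >> *+ n).
Proof.
have [n n_gt0 Bn] := product_monoid_torsion torsionK (free_monoid1 g).
exists n => //; split=> //; rewrite coeffMn coeffU eqxx mul1r.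
by rewrite natz.
Qed.

Lemma prime_s_idealMn (V : zmodType) (H p : set V) x n : submonoid H ->
  prime_s_ideal H p -> H x -> (0 < n)%N -> (p (x *+ n) <-> p x).
Proof.
move=> subH [[pH pD] subp] Hx n_gt0; split=> [pnx | px].
  apply: contrapT => Npx; have [_ []] : (H `\` p) (x *+ n) by apply: submonoidMn.
  exact: pnx.
rewrite -(prednK n_gt0) mulrS -pD; exists x => //.
by exists (x *+ n.-1) => //; apply: submonoidMn.
Qed.

Lemma common_torsion_exponent (s : seq G) :
  exists2 n, (0 < n)%N & forall g, g \in s -> K (g ^+ n)%g.
Proof.
elim: s => [|x s [n n_gt0 IHs]]; first by exists 1%N.
have [m m_gt0 Km] := torsionK x; exists (m * n)%N; first by rewrite muln_gt0 m_gt0.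
move=> g; rewrite inE => /orP [/eqP -> | /IHs Kn].
  by rewrite expgnA; apply: subgroupX => //; case: normalK.
by rewrite mulnC expgnA; apply: subgroupX => //; case: normalK.
Qed.

(** Given a in p, some multiple of a is the sum of the members n g of B, for g
    running over the terms of a; as p is prime, some n g lies in p. Every S in B
    through g has a multiple of the form (n g) k + S' with S' in B, hence lies in
    p as well. *)
Lemma sequences_through_sub_prime p : prime_s_ideal B p -> p !=set0 ->
  exists g, sequences_through g `<=` p.
Proof.
move=> primep [a pa]; have [[pB pD] subp] := primep.
have Ba := pB a pa; have [s _ es] := product_monoid_sub Ba.
have [n n_gt0 Kn] := common_torsion_exponent s.
have BU g : g \in s -> B (<< g >> *+ n).
  by move=> /Kn; rewrite -{1}[g]prodg1 -seq_sum1; apply: product_monoidX.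
have [g sg pg] : exists2 g, g \in s & p (<< g >> *+ n).
  apply: contrapT => Ng.
  have : p (a *+ n) by apply/(prime_s_idealMn subB primep Ba n_gt0).
  rewrite -es -sumrMnl => pS.
  have [_ []] : (B `\` p) (\sum_(g <- s) << g >> *+ n).
    apply: (submonoid_sum subp) => g sg; split; first exact: BU.
    by move=> pg; apply: Ng; exists g.
  exact: pS.
exists g => S [BS gS]; have [t _ et] := product_monoid_sub BS.
have tg : g \in t.
  by move: gS; rewrite -et coeff_seq_sum ltr0n -has_count has_pred1.
have eS : S = << g >> + seq_sum (rem g t).
  by rewrite -et -seq_sum_cons; apply/seq_sumP/perm_to_rem.
have [m m_gt0 Bm] := product_monoid_torsion torsionK (ex_intro2 _ _ (rem g t) I erefl).
apply/(prime_s_idealMn (n := n * m) subB primep BS); first by rewrite muln_gt0 n_gt0.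
rewrite eS mulrnDl -pD; exists (<< g >> *+ (n * m)); last first.
  by exists (seq_sum (rem g t) *+ (n * m)) => //; rewrite mulnC mulrnA; apply: submonoidMn.
by rewrite mulrnA; apply/(prime_s_idealMn subB primep (BU g sg) m_gt0).
Qed.

Lemma minimal_primesE : minimal_primes B = range sequences_through.
Proof.
have sequences_through_neq0 g : sequences_through g !=set0.
  by have [n _ gn] := sequences_through_nonempty g; exists (<< g >> *+ n).
apply/seteqP; split=> [p [primep p0 minp] | _ [g _ <-]].
  have [g gp] := sequences_through_sub_prime primep p0; exists g => //.
  by apply: minp => //; apply: sequences_through_prime.
split=> //; first exact: sequences_through_prime.
move=> q primeq q0 qg; apply/seteqP; split=> //.
have [h hq] := sequences_through_sub_prime primeq q0.
have [n n_gt0 hn] := sequences_through_nonempty h.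
suff -> : g = h by [].
have [_] := qg _ (hq _ hn); rewrite coeffMn coeffU mul1r.
by case: (eqVneq h g) => // _; rewrite mul0rn ltxx.
Qed.

Lemma sequences_through_finite a : B a ->
  finite_set [set p | minimal_primes B p /\ p a].
Proof.
move=> Ba; have [s _ es] := product_monoid_sub Ba.
apply: (sub_finite_set _ (finite_image sequences_through (finite_seq s))) => p [].
rewrite minimal_primesE => -[g _ <-] [_ ga]; exists g => //=.
by move: ga; rewrite -es coeff_seq_sum ltr0n -has_count has_pred1.
Qed.

(** An element of the localization at the sequences through g has a nonnegative
    coefficient at g, so the intersection consists of sequences. *)
Lemma weakly_Krull_abelian : commutator_subgroup G `<=` K -> weakly_Krull B.
Proof.
move=> derK; split=> //; last exact: sequences_through_finite.
apply/seteqP; split=> [x Bx | x [Qx locx]].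
  split; first exact: quotient_group_id.
  move=> p; rewrite minimal_primesE => -[g _ <-]; exists x => //.
  by exists 0; [case: (sequences_through_prime g) => _ [] | rewrite subr0].
have Fx : free_monoid G x.
  apply/freeP => g; have [] : localization B (sequences_through g) x.
    by apply: locx; rewrite minimal_primesE; exists g.
  move=> a Ba [b [Bb Nb] <-]; rewrite coeffB subr_ge0.
  apply: le_trans (coeff_ge0 g (product_monoid_sub Ba)).
  by rewrite leNgt; apply/negP => gb; apply: Nb.
move: Qx => [a Ba [b Bb e]].
apply/(product_monoid_divisor_closed normalK derK Bb Fx).
by rewrite -e addrC subrK.
Qed.

(** For w in G', the one-term sequence w is a quotient of members of B whose
    denominator, a sequence with products 1 and w^-1, can be chosen to avoid any
    given g, unless |G| <= 2 and G is abelian. So w lies in every localization at a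
    minimal prime, hence in B. *)
Lemma commutators_sub_of_weakly_Krull :
  weakly_Krull B -> commutator_subgroup G `<=` K.
Proof.
have [K1 KM KV] := normalK.1; move=> [_ eB _] w Gw.
have [third | /existsNP [g Ng]] :=
  pselect (forall g : G, exists u, u <> 1%g /\ u <> g); last first.
  apply: (abelian_commutators_sub (And3 K1 KM KV)) w Gw.
  apply: (@two_elements_commute _ g) => x.
  by apply: contrapT => /not_orP [x1 xg]; apply: Ng; exists x.
apply/product_monoid1; rewrite eB; split.
  apply: product_monoid_mulset_quotient => //; apply/product_monoid1.
  exact: commutators_sub_mulset.
move=> p; rewrite minimal_primesE => -[g _ <-].
have [u [u1 ug]] := third g.
have Gw' : commutator_subgroup G w^-1%g.
  by case: (subgroup_commutators G) => _ _; apply.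
have [s [t [est s1 tw gs]]] := commutator_rearrangement_avoiding u1 ug Gw'.
exists (seq_sum (w :: s)).
  apply/product_monoidP; exists (w :: t); first by rewrite perm_cons.
  by rewrite big_cons tw mulgV.
exists (seq_sum s); last by rewrite seq_sum_cons addrK.
split; first by apply: product_monoid_list; rewrite s1.
by move=> [_]; rewrite coeff_seq_sum ltr0n -has_count has_pred1 (negbTE gs).
Qed.

End MinimalPrimes.

(** * Conditions forcing commutators into the subgroup *)

Section Converses.
Variables (G : groupType) (K : set G).
Variables (normalK : normal_subgroup K) (torsionK : torsion_quotient K).
Notation B := (product_monoid K).
Notation F := (free_monoid G).
Notation N := (mulset K (commutator_subgroup G)).
Let subB : submonoid B := submonoid_product_monoid normalK.1.

Lemma product_monoid_nseq n w : B (<< w >> *+ n) <-> K (w ^+ n)%g.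
Proof.
rewrite -seq_sum_nseq; split=> [/product_monoidP [t] | Kn]; last first.
  by apply: product_monoid_list; rewrite prodg_nseq.
move=> ewt; suff -> : t = nseq n w by rewrite prodg_nseq.
have := perm_size ewt; rewrite size_nseq => ->.
apply/all_pred1P/allP => x; rewrite -(perm_mem ewt) mem_nseq.
by case/andP.
Qed.

(** For w in G' but not in K, let m > 1 be the order of w modulo K. The
    sequence of m copies of w is an atom, although the one-term sequence w is a
    difference of members of B. *)
Lemma commutators_sub_of_transfer_Krull :
  transfer_Krull B -> commutator_subgroup G `<=` K.
Proof.
move=> tK w Gw; apply: contrapT => NKw.
have Nw : N (prodg [:: w]) by rewrite prodg1; apply: commutators_sub_mulset.
have [t Bt] := mulset_commutators_rearrangement normalK Nw.
rewrite seq_sum_cat seq_sum1 => Bwt.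
have exK : exists n, (0 < n)%N && `[< K (w ^+ n)%g >].
  by have [n n_gt0 Kn] := torsionK w; exists n; rewrite n_gt0; apply/asboolP.
case: (ex_minnP exK) => m /andP [m_gt0 /asboolP Km] minm.
have m_gt1 : (1 < m)%N.
  by case: m m_gt0 Km {minm} => [|[|]] //; rewrite expg1.
apply: (transfer_Krull_atom tK Bt Bwt m_gt1).
have Bm : B (<< w >> *+ m) by apply/product_monoid_nseq.
have mu := munits_sub_free subB (@product_monoid_sub G K).
have m_neq0 n : (0 < n)%N -> << w >> *+ n <> 0 :> {freeg G}.
  move=> n_gt0; rewrite -seq_sum_nseq -seq_sum_nil => /seq_sumP /perm_size.
  by rewrite size_nseq; case: n n_gt0.
split=> //; first by rewrite mu; exact: m_neq0.
move=> b c Bb Bc e; rewrite mu.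
have wpow x y : F x -> F y -> << w >> *+ m = x + y ->
    exists2 i, (i <= m)%N & x = << w >> *+ i.
  move=> [s _ <-] [r _ <-]; rewrite -seq_sum_nseq -seq_sum_cat => /seq_sumP esr.
  exists (size s); first by rewrite -(size_nseq m w) (perm_size esr) size_cat leq_addr.
  rewrite -seq_sum_nseq; congr seq_sum; apply/all_pred1P/allP => g sg /=.
  have : g \in nseq m w by rewrite (perm_mem esr) mem_cat sg.
  by rewrite mem_nseq => /andP [].
have [i le_im eb] := wpow _ _ (product_monoid_sub Bb) (product_monoid_sub Bc) e.
case: (posnP i) => [i0 | i_gt0]; first by left; rewrite /= eb i0 mulr0n.
have le_mi : (m <= i)%N.
  by apply: minm; rewrite i_gt0; apply/asboolP/product_monoid_nseq; rewrite -eb.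
right; apply: (addrI b); rewrite -e addr0 eb.
by congr (_ *+ _); apply/eqP; rewrite eqn_leq le_mi.
Qed.

(** With t and w + t both in B, t divides w + t among sequences, hence in B, and
    the cofactor is w. *)
Lemma commutators_sub_of_divisor_hom :
  divisor_hom B F id -> commutator_subgroup G `<=` K.
Proof.
move=> [_ divB] w Gw.
have [t Bt] := @mulset_commutators_rearrangement _ _ normalK [:: w]
  (eq_ind_r N (commutators_sub_mulset normalK Gw) (prodg1 w)).
rewrite seq_sum_cat seq_sum1 => Bwt.
have [|c Bc e] := divB _ _ Bt Bwt.
  by exists << w >>; [apply: free_monoid1 | rewrite addrC].
apply/product_monoid1; suff -> : << w >> = c by [].
by apply: (addrI (seq_sum t)); rewrite -e addrC.
Qed.

(** Complete x, y to a sequence S whose class is the identity. Every product p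
    of S lies in K, since S + p^-1 is in B. Comparing the products of two
    orders of S that differ by exchanging x and y puts [~ x, y] in K. *)
Lemma commutators_sub_of_class_group :
  is_group (class_semigroup B F) (class_add B F) -> commutator_subgroup G `<=` K.
Proof.
have [[K1 KM KV] KJ] := normalK; have subF := submonoid_free G.
move=> [_ _ [_ [e0 Fe0 <-] [idE invE]]].
have idempotent : class_of B F e0 = class_of B F 0.
  have := (idE (class_of B F 0) (ex_intro2 _ _ 0 subF.1 erefl)).1.
  by rewrite class_addE ?addr0 //; case: subF.
apply: commutator_subgroup_sub => // x y.
have Fxy : F (seq_sum [:: x; y]) by exists [:: x; y].
have [_ [_ [z _ <-] <-]] := invE _ (ex_intro2 _ _ _ Fxy erefl).
have Fz : F (seq_sum z) by exists z.
rewrite class_addE // idempotent -seq_sum_cat => -[/class_of_eq ez _].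
have {}ez : class_equiv B F (seq_sum ([:: x; y] ++ z)) 0.
  by apply: ez; [exists ([:: x; y] ++ z) | case: subF].
have Kprod u : perm_eq ([:: x; y] ++ z) u -> K (prodg u).
  move=> eu; rewrite -[prodg u]invgK; apply: KV; apply/product_monoid1.
  rewrite -[<< _ >>]add0r; apply/ez; first exact: free_monoid1.
  rewrite -seq_sum1 -seq_sum_cat; apply/product_monoidP.
  exists (u ++ [:: (prodg u)^-1%g]).
    by rewrite perm_cat2r.
  by rewrite big_cat /= prodg1 mulgV.
have Kxy : K (x * y * prodg z)%g.
  by have := Kprod _ (perm_refl _); rewrite big_cat /= !big_cons big_nil mulg1.
have Kyx : K (y * x * prodg z)%g.
  have exy : perm_eq ([:: x; y] ++ z) ([:: y; x] ++ z).
    by rewrite perm_cat2r; apply/permPl/(perm_catC [:: x] [:: y]).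
  by have := Kprod _ exy; rewrite big_cat /= !big_cons big_nil mulg1.
have -> : [~ x, y]%g = (((y * x * prodg z)^-1 * (x * y * prodg z)) ^ (prodg z)^-1)%g.
  by rewrite conjgE commgEl conjgE !invgM !invgK !mulgA mulgK mulgV mul1g.
by apply: KJ; apply: KM => //; apply: KV.
Qed.

End Converses.

(** * Pigeonhole arguments in a finite group *)

Section Pigeonhole.

Lemma pigeonhole_count (T : eqType) (R l : seq T) k : {subset l <= R} ->
  (size R * k < size l)%N -> exists r, (k < count_mem r l)%N.
Proof.
elim: R l => [|r R IHR] l lR /= ltRl.
  by case: l lR ltRl => // x l /(_ x (mem_head _ _)).
have [le_rk | lt_kr] := leqP (count_mem r l) k; last by exists r.
pose l' := filter (predC1 r) l.
have sz : (count_mem r l + size l' = size l)%N by rewrite size_filter count_predC.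
have [||x] := IHR l'.
- by move=> x; rewrite mem_filter /= => /andP [xr /lR]; rewrite inE (negbTE xr).
- by move: ltRl sz; rewrite mulSn; lia.
move=> lt_kx; exists x; apply: leq_trans lt_kx _.
by rewrite count_filter; apply: sub_count => y /andP [].
Qed.

Lemma finite_bounded_seq (T : eqType) (R : seq T) n :
  (forall x, x \in R) -> finite_set [set s : seq T | (size s <= n)%N].
Proof.
move=> finT; elim: n => [|n IHn].
  apply: (sub_finite_set _ (finite_set1 [::])) => s /=.
  by rewrite leqn0 => /nilP.
have fin : finite_set ([set [::]] `|`
    [set x :: s | x in [set` R] & s in [set s | (size s <= n)%N]]).
  rewrite finite_setU; split; first exact: finite_set1.
  by apply: finite_image2; [exact: finite_seq | exact: IHn].
apply: (sub_finite_set _ fin) => -[|x s] /= le_sn; first by left.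
by right; exists x => //=; exists s.
Qed.

Variables (Q : groupType) (R : seq Q).
Hypothesis finQ : forall u : Q, u \in R.
Implicit Types (g r a : Q) (u v : seq Q).

(** The values of a * (product of the terms before), one for each occurrence of g
    in u: two occurrences with equal value delimit a segment of product 1. *)
Fixpoint prefixes g a u : seq Q :=
  if u is x :: u' then
    (if x == g then [:: a] else [::]) ++ prefixes g (a * x)%g u'
  else [::].

Lemma size_prefixes g a u : size (prefixes g a u) = count_mem g u.
Proof.
elim: u a => //= x u IHu a; rewrite size_cat IHu.
by case: eqP.
Qed.

Lemma first_prefix g a r u : r \in prefixes g a u -> exists u1 u2,
  [/\ u = u1 ++ g :: u2, (a * prodg u1)%g = r &
      count_mem r (prefixes g a u) = (count_mem r (prefixes g (r * g)%g u2)).+1].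
Proof.
elim: u a => //= x u IHu a.
have later : a != r \/ x != g -> r \in prefixes g (a * x)%g u -> exists u1 u2,
  [/\ x :: u = u1 ++ g :: u2, (a * prodg u1)%g = r &
      count_mem r ((if x == g then [:: a] else [::]) ++ prefixes g (a * x)%g u) =
      (count_mem r (prefixes g (r * g)%g u2)).+1].
  move=> ax /IHu [u1 [u2 [-> e1 e2]]]; exists (x :: u1), u2.
  rewrite big_cons mulgA e1 count_cat e2; split=> //.
  by case: (eqVneq x g) ax => [_ [/negbTE /= -> | //] | _ _].
rewrite mem_cat; have [exg | xg] := eqVneq x g; last first.
  by move: (later); rewrite (negbTE xg) => + rpre; apply=> //; right.
rewrite {}exg eqxx in later *.
have [-> _ | ar] := eqVneq a r.
  by exists [::], u; rewrite big_nil mulg1 /= eqxx.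
by rewrite inE eq_sym (negbTE ar) /= => rpre; apply: later; [left|].
Qed.

(** If the prefixes before k + 1 occurrences of g all have the value r, each
    segment between consecutive ones starts with g and has product 1, so the
    rest of the segment has product g^-1. Removing the first k of these
    occurrences therefore changes the product only by a factor g ^- k, up to
    conjugation; w is the part from the last occurrence on, and v what remains
    before it. *)
Lemma remove_repeated g a r k u : (k < count_mem r (prefixes g a u))%N ->
  exists v w, [/\ perm_eq u (nseq k g ++ v ++ w),
    (a * prodg v * g ^+ k)%g = r & (a * prodg u = r * prodg w)%g].
Proof.
elim: k a u => [|k IHk] a u lt_k.
  have [|u1 [u2 [-> e1 _]]] := @first_prefix g a r u.
    by rewrite -has_pred1 has_count; apply: leq_trans lt_k.
  exists u1, (g :: u2); rewrite expg0 mulg1 e1; split=> //.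
  by rewrite big_cat /= mulgA e1.
have [|u1 [u2 [eu e1 e2]]] := @first_prefix g a r u.
  by rewrite -has_pred1 has_count; apply: leq_trans lt_k.
have [|v [w [puw ev ew]]] := IHk (r * g)%g u2; first by rewrite -ltnS -e2.
exists (u1 ++ v), w; rewrite eu; split.
- rewrite -cat1s perm_catCA -[nseq k.+1 g]/([:: g] ++ nseq k g) -catA perm_cat2l.
  rewrite -[(u1 ++ v) ++ w]catA perm_sym perm_catCA perm_cat2l perm_sym //.
- rewrite big_cat /= mulgA e1 expgSr mulgA.
  have /mulg1_eq e : (g * (prodg v * g ^+ k) = 1)%g.
    by apply: (mulgI r); rewrite mulg1 !mulgA.
  by rewrite -(mulgA r) -e mulgVK.
- by rewrite big_cat big_cons /= !mulgA e1 ew.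
Qed.

(** Among that many occurrences of g, more than k have the same prefix product. *)
Lemma remove_power g k u : (g ^+ k = 1)%g -> (size R * k < count_mem g u)%N ->
  exists2 v, perm_eq u (nseq k g ++ v) & prodg v = prodg u.
Proof.
move=> gk lt_k; have [||r lt_kr] := @pigeonhole_count Q R (prefixes g 1%g u) k.
- by move=> x _.
- by rewrite size_prefixes.
have [v [w [puw ev ew]]] := remove_repeated lt_kr; exists (v ++ w) => //.
by rewrite big_cat /=; move: ev ew; rewrite gk mulg1 !mul1g => -> ->.
Qed.

(** Two of the products of nonempty prefixes coincide. *)
Lemma cut_trivial_segment u : (size R < size u)%N -> exists u1 u2 u3,
  [/\ u = u1 ++ u2 ++ u3, u1 <> [::], u2 <> [::] & prodg u2 = 1%g].
Proof.
move=> ltRu; pose l := [seq prodg (take i.+1 u) | i <- iota 0 (size u)].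
have sl : size l = size u by rewrite size_map size_iota.
have : ~~ uniq l.
  apply/negP => Ul; have := uniq_leq_size Ul (s2 := R) (fun x _ => finQ x).
  by rewrite sl leqNgt ltRu.
move/(uniqPn 1%g) => [i [j [lt_ij lt_jl]]]; rewrite sl in lt_jl.
rewrite !(nth_map 0%N) ?size_iota ?(ltn_trans lt_ij) // !nth_iota ?(ltn_trans lt_ij) //.
rewrite !add0n => e.
exists (take i.+1 u), (drop i.+1 (take j.+1 u)), (drop j.+1 u).
have e1 : take i.+1 u = take i.+1 (take j.+1 u) by rewrite take_takel // ltnS ltnW.
split.
- by rewrite catA e1 cat_take_drop cat_take_drop.
- by case: (u) lt_jl.
- move=> /(congr1 size); rewrite size_drop size_take_min /=.
  by move: lt_ij lt_jl; lia.
apply: (mulgI (prodg (take i.+1 u))); rewrite mulg1 {2}e {1}e1.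
by rewrite -[in RHS](cat_take_drop i.+1 (take j.+1 u)) big_cat.
Qed.

End Pigeonhole.

(** * Finite quotients *)

Lemma finite_quotient_morphism (G : groupType) (K : set G) :
  normal_subgroup K -> finite_set (quotient K) ->
  exists (Q : groupType) (f : UMagmaMorphism.type G Q) (R : seq Q),
    [/\ forall u, exists x, f x = u, forall x, K x <-> f x = 1%g &
        forall u, u \in R].
Proof.
move=> normalK finK; have [Q [f [surjf kerf]]] := quotient_morphism normalK.
have /finite_seqP [R eR] := finite_image (fun C => f (xget 1%g C)) finK.
exists Q, f, R; split=> // u; have [x <-] := surjf u.
suff : [set` R] (f x) by [].
rewrite -eR; exists (mulset [set x] K); first by exists x.
have : mulset [set x] K (xget 1%g (mulset [set x] K)).
  by apply: (@xgetI _ _ _ x); apply/mem_cosetP; rewrite mulVg; apply/kerf; rewrite gmulf1.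
move=> /mem_cosetP /kerf; rewrite gmulfM gmulfV => e.
by apply: (mulgI (f x)^-1%g); rewrite e mulVg.
Qed.

Section FiniteQuotient.
Variables (G Q : groupType) (f : UMagmaMorphism.type G Q) (R : seq Q).
Variables (K : set G) (normalK : normal_subgroup K).
Hypotheses (surjf : forall u, exists x, f x = u).
Hypotheses (kerf : forall x, K x <-> f x = 1%g) (finQ : forall u, u \in R).
Notation B := (product_monoid K).
Notation F := (free_monoid G).
Let subB : submonoid B := submonoid_product_monoid normalK.1.

(** Membership in the product monoid, read in the quotient group. *)
Definition product_one (u : seq Q) := exists2 v, perm_eq u v & prodg v = 1%g.

Lemma product_monoid_map s : B (seq_sum s) <-> product_one (map f s).
Proof.
split=> [/product_monoidP [t est /kerf ft] | [u /perm_map_preimage [t est <-] ft]].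
  by exists (map f t); [exact: perm_map | rewrite -prodg_map].
by apply/product_monoidP; exists t => //; apply/kerf; rewrite prodg_map.
Qed.

Lemma atom_size s : atom B (seq_sum s) -> (size s <= size R)%N.
Proof.
move=> [/product_monoidP [t /[dup] est /seq_sumP -> /kerf]].
rewrite (perm_size est) prodg_map => ft _ atomt; rewrite leqNgt -(size_map f).
apply/negP => /(cut_trivial_segment finQ) [u1 [u2 [u3 [et u1n u2n e2]]]].
have mu := munits_sub_free subB (@product_monoid_sub G K).
(* Transport the decomposition of the image back to the sequence t. *)
pose n1 := size u1; pose n2 := size u2.
pose t1 := take n1 t; pose t2 := take n2 (drop n1 t); pose t3 := drop n2 (drop n1 t).
have ett : t = t1 ++ t2 ++ t3 by rewrite !cat_take_drop.
have m1 : map f t1 = u1 by rewrite map_take et take_size_cat.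
have m2 : map f t2 = u2 by rewrite map_take map_drop et drop_size_cat // take_size_cat.
have m3 : map f t3 = u3 by rewrite !map_drop et !drop_size_cat.
have B2 : B (seq_sum t2) by apply/product_monoid_list/kerf; rewrite prodg_map m2.
have B13 : B (seq_sum (t1 ++ t3)).
  apply/product_monoid_list/kerf; rewrite prodg_map map_cat m1 m3.
  by move: ft; rewrite et !big_cat /= e2 mul1g.
have e : seq_sum t = seq_sum t2 + seq_sum (t1 ++ t3).
  by rewrite {1}ett !seq_sum_cat addrCA.
have nz (r : seq G) : seq_sum r = 0 -> r = [::].
  by rewrite -seq_sum_nil => /seq_sumP /perm_nilP.
rewrite mu in atomt; case: (atomt _ _ B2 B13 e) => /nz e'.
  by apply: u2n; rewrite -m2 e'.
apply: u1n; rewrite -m1; by case: (t1) e'.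
Qed.

Lemma finite_group_exponent : exists2 e, (0 < e)%N & forall u : Q, (u ^+ e = 1)%g.
Proof.
have tor (u : Q) : exists2 n, (0 < n)%N & (u ^+ n = 1)%g.
  have : ~~ uniq [seq (u ^+ i)%g | i <- iota 0 (size R).+1].
    apply/negP => Ul; have := uniq_leq_size Ul (s2 := R) (fun x _ => finQ x).
    by rewrite size_map size_iota ltnn.
  move/(uniqPn 1%g) => [i [j [lt_ij]]]; rewrite size_map size_iota => lt_j.
  rewrite !(nth_map 0%N) ?size_iota ?(ltn_trans lt_ij) // !nth_iota ?(ltn_trans lt_ij) //.
  rewrite !add0n => e; exists (j - i)%N; first by rewrite subn_gt0.
  by rewrite expgnFr ?(ltnW lt_ij) // e mulgV.
have [e e_gt0 He] : exists2 e, (0 < e)%N & forall u, u \in R -> (u ^+ e = 1)%g.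
  elim: (R) => [|x s [n n_gt0 IHs]]; first by exists 1%N.
  have [m m_gt0 xm] := tor x; exists (m * n)%N; first by rewrite muln_gt0 m_gt0.
  move=> g; rewrite inE => /orP [/eqP -> | /IHs gn].
    by rewrite expgnA xm expg1n.
  by rewrite mulnC expgnA gn expg1n.
by exists e => // u; apply: He.
Qed.

(** Let e be an exponent of Q. As long as some g occurs more than |Q| e + e
    times, deleting e copies of g changes nothing: they can be inserted in front
    of any product, and removed from any product by the previous pigeonhole
    argument. A sequence that cannot be shortened has length at most
    |Q| (|Q| e + e). *)
Lemma bounded_representative : exists L, forall u, exists2 u', (size u' <= L)%N &
  forall v, product_one (u ++ v) <-> product_one (u' ++ v).
Proof.
have [e e_gt0 exp_e] := finite_group_exponent; pose m := (size R * e + e)%N.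
exists (size R * m)%N => u.
have [n] := ubnP (size u); elim: n => // n IHn in u *; rewrite ltnS => le_un.
have [le_uL | lt_Lu] := leqP (size u) (size R * m); first by exists u.
have [|g lt_mg] := @pigeonhole_count Q R u m _ lt_Lu; first by move=> x _.
pose c := count_mem g u; pose u1 := nseq (c - e) g ++ filter (predC1 g) u.
have le_ec : (e <= c)%N by rewrite ltnW // (leq_trans _ lt_mg) // ltnS leq_addl.
have pu : perm_eq u (nseq e g ++ u1).
  rewrite catA -nseqD subnKC // /c -size_filter.
  by rewrite -(all_pred1P g _ (filter_all _ _)) perm_sym perm_filterC.
have u1v v : product_one (u ++ v) <-> product_one (u1 ++ v).
  split=> [[w pw w1] | [w pw w1]].
    have [|w' pw' w'1] := @remove_power Q R finQ g e w (exp_e g).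
      rewrite -(permP pw) count_cat (leq_trans _ (leq_addr _ _)) // -(ltn_add2r e).
      by rewrite (leq_trans lt_mg) // leq_addr.
    exists w'; last by rewrite w'1.
    rewrite -(perm_cat2l (nseq e g)) catA -(permPr pw') -(permPr pw) perm_cat2r.
    by rewrite perm_sym.
  exists (nseq e g ++ w); last by rewrite big_cat /= prodg_nseq exp_e mul1g.
  apply: (@perm_trans _ ((nseq e g ++ u1) ++ v)); first by rewrite perm_cat2r.
  by rewrite -catA perm_cat2l.
have [|u' le_u' u'v] := IHn u1.
  by rewrite (leq_trans _ le_un) // (perm_size pu) size_cat size_nseq -addn1 addnC leq_add2r.
by exists u' => // v; rewrite u1v.
Qed.

Lemma classes_finite : finite_set (class_semigroup B F).
Proof.
have [L rep] := bounded_representative.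
pose h u := xget 1%g [set x | f x = u].
have hK u : f (h u) = u.
  by have [x fx] := surjf u; apply: (@xgetI _ _ [set x | f x = u] x).
apply: (sub_finite_set _ (finite_image (fun u => class_of B F (seq_sum (map h u)))
  (finite_bounded_seq L finQ))).
move=> _ [_ [s _ <-] <-]; have [u le_uL su] := rep (map f s); exists u => //.
apply/class_of_eq; [by exists (map h u) | by exists s | move=> _ [t _ <-]].
rewrite -!seq_sum_cat !product_monoid_map !map_cat su -map_comp.
by rewrite (eq_map hK) map_id.
Qed.

Lemma product_monoid_C_monoid : C_monoid B.
Proof.
exists {freeg G}, F, id; split.
- exact: factorial_free.
- exact: (sub_free_monoid_hom subB (@product_monoid_sub _ _)).
- by move=> x y _ _.
- rewrite image_id !munits_sub_free //; [|exact: product_monoid_sub | exact: submonoid_free].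
  by apply/seteqP; split=> [x [] | _ ->]; last by split; case: subB.
rewrite image_id; apply: sub_finite_set classes_finite => _ [y Fy <-]; exists y => //.
by case: Fy => [[] | ->]; last by case: (submonoid_free G).
Qed.

Lemma Davenport_constant_exists : exists d, Davenport_constant K d.
Proof.
apply: nat_supremums_neq0; exists (size R) => _ [s atoms <-].
exact: atom_size.
Qed.

End FiniteQuotient.

Lemma finite_group_of_quotient (G : groupType) (K : set G) : normal_subgroup K ->
  finite_set (quotient K) -> finite_set K -> finite_set [set: G].
Proof.
move=> normalK /(finite_image (xget 1%g)) finR finK.
apply: (sub_finite_set _ (finite_image2 (fun x y => (x * y)%g) finR finK)) => g _.
have [[K1 KM KV] _] := normalK.
set r := xget 1%g (mulset [set g] K).
have : mulset [set g] K r by apply: (@xgetI _ _ _ g); apply/mem_cosetP; rewrite mulVg.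
move=> /mem_cosetP /KV; rewrite invgM invgK => Kr.
exists r; first by exists (mulset [set g] K) => //; exists g.
by exists (r^-1 * g)%g => //; rewrite mulVKg.
Qed.

Lemma product_monoid_finitely_generated (G : groupType) (K : set G) :
  normal_subgroup K -> finite_set [set: G] -> finitely_generated (product_monoid K).
Proof.
move=> normalK finG.
have finK := finite_image (fun g => mulset [set g] K) finG.
have [Q [f [R [_ kerf finQ]]]] := finite_quotient_morphism normalK finK.
have /finite_seqP [RG eRG] := finG.
have inRG g : g \in RG by have : [set: G] g by []; rewrite eRG.
apply: sub_free_finitely_generated.
- exact: submonoid_product_monoid normalK.1.
- exact: product_monoid_sub.
apply: (sub_finite_set _ (finite_image (@seq_sum G) (finite_bounded_seq (size R) inRG))).
move=> x /[dup] -[/product_monoid_sub [s _ <-] _ _] atoms.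
by exists s => //=; apply: (atom_size normalK kerf finQ).
Qed.

(** * The characterization *)

Lemma transfer_hom_id (V : zmodType) (H : set V) :
  submonoid H -> transfer_hom H H id.
Proof.
move=> subH; have [H0 HD] := subH; split=> //.
  apply/seteqP; split=> [x Hx | _ [_ [x Hx <-] [u [Hu _] <-]]]; last exact: HD.
  by exists x; [exists x | exists 0; [split; rewrite ?oppr0 | rewrite addr0]].
by move=> u b c Hu Hb Hc e; exists b, c.
Qed.

Theorem theorem3p3 (G : groupType) (K : set G)
    (normalK : normal_subgroup K) (torsionGK : torsion_quotient K) :
  let B := product_monoid K in
  let B_hat := complete_integral_closure B in
  let F := free_monoid G in
  let G' := commutator_subgroup G in
  let KG' := mulset K G' in
  let exceptional := [set: G] #= `I_2 /\ K #= `I_1 in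
  (* 1 *)
  [/\ BF_monoid B,
      Krull B_hat,
      ~ exceptional ->
        [/\ divisor_theory B_hat F id,
            class_group B_hat F id = residue_classes K,
            magma_isomorphic (residue_classes K) (@addset _)
              (quotient KG') (@mulset _) &
            forall C, residue_classes K C -> [set g | C << g >>] #= KG'] &
      finite_set (quotient K) ->
        [/\ C_monoid B,
            exists d : nat, Davenport_constant K d,
            Krull B_hat &
            finite_set K -> finitely_generated B /\ finitely_generated B_hat]]
  /\
  (* 2 *)
  [<-> G' `<=` K;
       Krull B;
       completely_integrally_closed B;
       root_closed B;
       transfer_Krull B;
       weakly_Krull B;
       ~ exceptional -> divisor_theory B F id;
       divisor_hom B F id;
       is_group (class_semigroup B F) (class_add B F)]
  /\
  (G' `<=` K ->
     magma_isomorphic (class_semigroup B F) (class_add B F)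
       (quotient K) (@mulset _)).
Proof.
move=> B B_hat F G' KG' exceptional.
have subK := normalK.1; have subB : submonoid B := submonoid_product_monoid subK.
have BF : B `<=` F := @product_monoid_sub G K.
have normalN : normal_subgroup KG' := normal_mulset_commutators normalK.
have derN : G' `<=` KG' := commutators_sub_mulset normalK.
have B_hatE : B_hat = product_monoid KG'.
  exact: complete_integral_closure_product_monoid.
have KrullN : Krull B_hat.
  rewrite B_hatE; exists {freeg G}, F, id.
  by split; [exact: free_abelian_free | exact: product_monoid_divisor_hom].
have Krull_transfer : Krull B -> transfer_Krull B.
  by move=> KB; exists {freeg G}, B, id; split=> //; apply: transfer_hom_id.
have theoryN : ~ exceptional -> divisor_theory B_hat F id.
  move=> nexc; rewrite B_hatE; apply: divisor_theory_product_monoid => // h NNh.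
  apply: (third_element subK nexc) => Kh; apply: NNh.
  exact: sub_mulset_commutators.
have closed_der : B = product_monoid KG' -> G' `<=` K.
  by move=> eB w Gw; apply/product_monoid1; rewrite -/B eB; apply/product_monoid1/derN.
have der_closed : G' `<=` K -> product_monoid KG' = B.
  by move=> derK; rewrite /KG' mulset_commutators_id.
split; last split.
- split=> //; first exact: sub_free_BF.
    move=> nexc; split; first exact: theoryN.
    + by rewrite B_hatE; apply: class_group_residue_classes.
    + exact: residue_classes_isomorphic.
    + by move=> C; apply: residue_prime_divisors.
  move=> finGK.
  have [Q [f [R [surjf kerf finQ]]]] := finite_quotient_morphism normalK finGK.
  split=> //.
  + exact: (product_monoid_C_monoid normalK surjf kerf finQ).
  + exact: (Davenport_constant_exists normalK kerf finQ).
  move=> finK; have finG := finite_group_of_quotient normalK finGK finK.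
  by split; rewrite ?B_hatE; apply: product_monoid_finitely_generated.
- tfae.
  + by move=> derK; move: KrullN; rewrite B_hatE der_closed.
  + move=> /Krull_transfer tK; rewrite /completely_integrally_closed -/B_hat B_hatE.
    by rewrite der_closed //; apply: commutators_sub_of_transfer_Krull.
  + rewrite /completely_integrally_closed -/B_hat B_hatE => /closed_der derK.
    by rewrite /root_closed root_closure_product_monoid // -/KG' der_closed.
  + rewrite /root_closed root_closure_product_monoid // => /closed_der derK.
    by apply: Krull_transfer; move: KrullN; rewrite B_hatE der_closed.
  + move=> tK; apply: weakly_Krull_abelian => //.
    exact: commutators_sub_of_transfer_Krull.
  + move=> wK nexc; move: (theoryN nexc); rewrite B_hatE der_closed //.
    exact: commutators_sub_of_weakly_Krull.
  + move=> theoryB; have [exc | /theoryB [] //] := pselect exceptional.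
    have [g Gg] := two_elements exc.1.
    apply: product_monoid_divisor_hom => //; apply: abelian_commutators_sub => //.
    exact: two_elements_commute Gg.
  + move=> divB; apply: class_semigroup_group => //.
    exact: commutators_sub_of_divisor_hom.
  + exact: commutators_sub_of_class_group.
- by move=> derK; apply: class_semigroup_isomorphic.
Qed.
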